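(* Let $H$ be a Hopf algebra over $\mathbb{C}$ with unit $1$, coproduct $\Delta$, counit $\varepsilon$ and antipode $S$. Let $(\delta,\sigma)$ be a modular pair in involution for $H$: $\delta:H\to\mathbb{C}$ is a character, $\sigma\in H$ is group-like, $\delta(\sigma)=1$, and the linear map $h\mapsto \sigma^{-1}\widetilde S(h)$ has square equal to the identity of $H$, where $\widetilde S(h)=\sum \delta(h_{(1)})\,S(h_{(2)})$. Consider the vector spaces $H^{\otimes n}$, $n\ge 0$ (with $H^{\otimes 0}=\mathbb{C}$), with the following operators. Face operators $\delta_i:H^{\otimes (n-1)}\to H^{\otimes n}$, $0\le i\le n$, $n\ge 1$: $$\delta_0(h^1\otimes\cdots\otimes h^{n-1})=1\otimes h^1\otimes\cdots\otimes h^{n-1},$$ $$\delta_j(h^1\otimes\cdots\otimes h^{n-1})=h^1\otimes\cdots\otimes\Delta h^j\otimes\cdots\otimes h^{n-1}\quad(1\le j\le n-1),$$ $$\delta_n(h^1\otimes\cdots\otimes h^{n-1})=h^1\otimes\cdots\otimes h^{n-1}\otimes\sigma$$ (for $n=1$: $\delta_0(1)=1$, $\delta_1(1)=\sigma$). Degeneracy operators $\sigma_i:H^{\otimes(n+1)}\to H^{\otimes n}$, $0\le i\le n$, $n\ge 0$: $$\sigma_i(h^1\otimes\cdots\otimes h^{n+1})=\varepsilon(h^{i+1})\,h^1\otimes\cdots\otimes h^i\otimes h^{i+2}\otimes\cdots\otimes h^{n+1}.$$ Cyclic operators $\tau_n:H^{\otimes n}\to H^{\otimes n}$: $$\tau_n(h^1\otimes\cdots\otimes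 h^n)=\big(\Delta^{n-1}\widetilde S(h^1)\big)\cdot\big(h^2\otimes\cdots\otimes h^n\otimes\sigma\big)\quad (n\ge 1),\qquad \tau_0=\mathrm{id}_{\mathbb{C}}.$$ Then $\{H^{\otimes n}\}_{n\ge 0}$ equipped with these operators is a module over the cyclic category $\Lambda$.
   Context: Sweedler notation $\Delta h=\sum h_{(1)}\otimes h_{(2)}$ is used. A character of $H$ is a unital algebra homomorphism $H\to\mathbb{C}$; an element $\sigma$ is group-like if $\Delta\sigma=\sigma\otimes\sigma$ and $\varepsilon(\sigma)=1$. $\Delta^{n-1}:H\to H^{\otimes n}$ is the iterated coproduct ($\Delta^0=\mathrm{id}$, $\Delta^1=\Delta$), and $\cdot$ denotes the componentwise product of the algebra $H^{\otimes n}$. A module over the cyclic category $\Lambda$ (here in the covariant, i.e. cocyclic, sense) is a sequence of vector spaces $(X^n)_{n\ge0}$ with linear maps $\delta_i:X^{n-1}\to X^n$ and $\sigma_i:X^{n+1}\to X^n$ ($0\le i\le n$) satisfying the cosimplicial identities $$\delta_j\delta_i=\delta_i\delta_{j-1}\ (i<j),\qquad \sigma_j\sigma_i=\sigma_i\sigma_{j+1}\ (i\le j),$$ $$\sigma_j\delta_i=\delta_i\sigma_{j-1}\ (i<j),\qquad \sigma_j\delta_i=\mathrm{id}\ (i=j \text{ or } i=j+1),\qquad \sigma_j\delta_i=\delta_{i-1}\sigma_j\ (i>j+1),$$ together with linear maps $\tau_n:X^n\to X^n$ satisfying $$\tau_n\delta_i=\delta_{i-1}\tau_{n-1}\ (1\le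 i\le n),\qquad \tau_n\delta_0=\delta_n,$$ $$\tau_n\sigma_i=\sigma_{i-1}\tau_{n+1}\ (1\le i\le n),\qquad \tau_n\sigma_0=\sigma_n\tau_{n+1}^2,\qquad \tau_n^{n+1}=\mathrm{id}.$$ *)

(* Defs.v *)
From HB Require Import structures.
From mathcomp Require Import all_boot all_order all_algebra.
From mathcomp Require Import boolp reals complex freeg zify.

Set Implicit Arguments.
Unset Strict Implicit.
Unset Printing Implicit Defensive.

Import GRing.Theory.
Local Open Scope ring_scope.
Local Open Scope quotient_scope.

Definition multilinear (K : fieldType) (H V : lmodType K) (n : nat)
    (f : seq H -> V) : Prop :=
  forall (s1 s2 : seq H) (a : K) (x y : H), (size s1 + (size s2).+1 = n)%N ->
    f (s1 ++ (a *: x + y) :: s2) = a *: f (s1 ++ x :: s2) + f (s1 ++ y :: s2).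

Section TensorPower.
Variables (K : fieldType) (H : lmodType K).

(* Truncates or pads with 0 when [size s != n]; only meaningful otherwise. *)
Definition seq_tuple (n : nat) (s : seq H) : n.-tuple H :=
  [tuple s`_i | i < n].

Lemma seq_tupleE n s : size s = n -> seq_tuple n s = s :> seq H.
Proof.
move=> sn; apply: (@eq_from_nth _ 0); first by rewrite size_tuple sn.
move=> i; rewrite size_tuple => lt_in.
by rewrite (_ : i = Ordinal lt_in :> nat) // -tnth_nth tnth_mktuple.
Qed.

Lemma seq_tupleK n (t : n.-tuple H) : seq_tuple n t = t.
Proof. by apply: val_inj; rewrite /= seq_tupleE ?size_tuple. Qed.

Local Notation free n := {freeg (n.-tuple H) / K}.

Inductive tensor_rel (n : nat) : free n -> Prop :=
| tensor_rel_gen (s1 s2 : seq H) (a : K) (x y : H) :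
    (size s1 + (size s2).+1 = n)%N ->
    tensor_rel (<< seq_tuple n (s1 ++ (a *: x + y) :: s2) >>
                - (a *: << seq_tuple n (s1 ++ x :: s2) >>
                   + << seq_tuple n (s1 ++ y :: s2) >>))
| tensor_rel0 : tensor_rel 0
| tensor_relL (a : K) (u v : free n) :
    tensor_rel u -> tensor_rel v -> tensor_rel (a *: u + v).

Definition tensor_relb (n : nat) : {pred free n} := fun g => `[< tensor_rel g >].

Lemma tensor_relbP n g : reflect (tensor_rel g) (g \in @tensor_relb n).
Proof. exact: asboolP. Qed.

Lemma tensor_rel_zmod n : zmod_closed (@tensor_relb n).
Proof.
split=> [|u v /tensor_relbP Ru /tensor_relbP Rv].
  exact/tensor_relbP/tensor_rel0.
by apply/tensor_relbP; rewrite addrC -scaleN1r; apply: tensor_relL.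
Qed.

HB.instance Definition _ n :=
  GRing.isZmodClosed.Build (free n) (@tensor_relb n) (@tensor_rel_zmod n).

(* The n-th tensor power of H over K: the free vector space on n-tuples of
   elements of H modulo the multilinearity relations. *)
Definition tpow (n : nat) : Type := Quotient.quot (@tensor_relb n).

HB.instance Definition _ n := Choice.on (tpow n).
HB.instance Definition _ n := GRing.Zmodule.on (tpow n).


Definition tpi n (g : free n) : tpow n :=
  \pi_(Quotient.quot (@tensor_relb n)) g.

Definition trepr n (u : tpow n) : free n := repr u.

Lemma treprK n : cancel (@trepr n) (@tpi n).
Proof. exact: reprK. Qed.

Lemma tpi_additive n : {morph @tpi n : g g' / g + g'}.
Proof. exact: (raddfD \pi_(Quotient.quot (@tensor_relb n))). Qed.

Lemma tpi0 n : @tpi n 0 = 0.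
Proof. exact: (raddf0 \pi_(Quotient.quot (@tensor_relb n))). Qed.

Lemma pi_tpowP n (g g' : free n) :
  reflect (tpi g = tpi g') (g - g' \in @tensor_relb n).
Proof. by rewrite Quotient.idealrBE; apply: eqP. Qed.

Definition tscale n (a : K) (u : tpow n) : tpow n := tpi (a *: trepr u).

Lemma pi_tscale n a (g : free n) : tpi (a *: g) = tscale a (tpi g).
Proof.
have /tensor_relbP Rg : g - trepr (tpi g) \in @tensor_relb n.
  by apply/pi_tpowP; rewrite treprK.
apply/pi_tpowP/tensor_relbP; rewrite -scalerBr -[_ *: _]addr0.
by apply: tensor_relL => //; apply: tensor_rel0.
Qed.

Lemma tscaleA n a b (u : tpow n) : tscale a (tscale b u) = tscale (a * b) u.
Proof. by rewrite -[u]treprK -(pi_tscale b) -!pi_tscale scalerA. Qed.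

Lemma tscale1 n : left_id 1 (@tscale n).
Proof. by move=> u; rewrite -[u]treprK -!pi_tscale scale1r. Qed.

Lemma tscaleDr n : right_distributive (@tscale n) +%R.
Proof.
move=> a u v; rewrite -[u]treprK -[v]treprK -!pi_tscale.
by rewrite -!tpi_additive -pi_tscale scalerDr.
Qed.

Lemma tscaleDl n (u : tpow n) : {morph (@tscale n)^~ u : a b / a + b}.
Proof.
by move=> a b; rewrite -[u]treprK -!pi_tscale scalerDl tpi_additive.
Qed.

HB.instance Definition _ n := GRing.Zmodule_isLmodule.Build K (tpow n)
  (@tscaleA n) (@tscale1 n) (@tscaleDr n) (@tscaleDl n).

Lemma pi_tpowZ n a (g : free n) : tpi (a *: g) = a *: tpi g.
Proof. exact: pi_tscale. Qed.

Lemma pi_tpowD n (g g' : free n) : tpi (g + g') = tpi g + tpi g'.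
Proof. exact: tpi_additive. Qed.

(* [pure n [:: h1; ..; hn]] is the elementary tensor h1 (x) .. (x) hn. *)
Definition pure (n : nat) (s : seq H) : tpow n :=
  tpi << seq_tuple n s >>.

Lemma pure_multilinear n : multilinear n (pure n).
Proof.
move=> s1 s2 a x y sn; rewrite /pure -pi_tpowZ -pi_tpowD.
by apply/pi_tpowP/tensor_relbP/tensor_rel_gen.
Qed.

Section Lift.
Variables (n : nat) (V : lmodType K) (f : seq H -> V).

(* The linear map on the n-th tensor power which sends h1 (x) .. (x) hn to
   [f [:: h1; ..; hn]]; only meaningful when [f] is n-multilinear. *)
Definition tlift (u : tpow n) : V := fglift (fun t : n.-tuple H => f t) (trepr u).

Let F := fglift (fun t : n.-tuple H => f t).

Let F_additive : {additive {freeg (n.-tuple H) / K} -> V} :=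
  HB.pack F (GRing.isZmodMorphism.Build _ _ F (lift_is_additive _)).

Let FB (g g' : free n) : F (g - g') = F g - F g'.
Proof. exact: (raddfB F_additive). Qed.

Let FD (g g' : free n) : F (g + g') = F g + F g'.
Proof. exact: (raddfD F_additive). Qed.

Let FZ a (g : free n) : F (a *: g) = a *: F g.
Proof.
rewrite -[F]/(F_additive : _ -> _) -[in RHS](freeg_sumE g) !raddf_sum.
apply: eq_bigr => t _.
by rewrite /= /F !liftU scalerA.
Qed.

Let F_rel g : multilinear n f -> tensor_rel g -> F g = 0.
Proof.
move=> f_lin; elim=> {g} [s1 s2 a x y sn||a u v _ Fu _ Fv].
- rewrite FB; apply/eqP; rewrite subr_eq0; apply/eqP.
  by rewrite FD FZ /F !liftU !scale1r !seq_tupleE ?size_cat // f_lin.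
- exact: (raddf0 F_additive).
- by rewrite FD FZ Fu Fv scaler0 addr0.
Qed.

Let tliftE g : multilinear n f -> tlift (tpi g) = F g.
Proof.
move=> f_lin; apply/eqP; rewrite -subr_eq0 -FB F_rel //.
by apply/tensor_relbP/pi_tpowP; rewrite treprK.
Qed.

Lemma tlift_linear : multilinear n f -> linear tlift.
Proof.
move=> f_lin a u v; rewrite -[u]treprK -[v]treprK -pi_tpowZ -pi_tpowD !tliftE //.
by rewrite FD FZ.
Qed.

Lemma tlift_pure s : multilinear n f -> size s = n -> tlift (pure n s) = f s.
Proof.
by move=> f_lin sn; rewrite /pure tliftE // /F liftU scale1r seq_tupleE.
Qed.

End Lift.

Lemma tlift_comb n (V : lmodType K) (f g h : seq H -> V) (a : K) (u : tpow n) :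
    (forall t, size t = n -> f t = a *: g t + h t) ->
  tlift f u = a *: tlift g u + tlift h u.
Proof.
move=> fgh; rewrite /tlift -(Freeg_enum (trepr u)) !fglift_Freeg /prelift.
rewrite scaler_sumr -big_split; apply: eq_bigr => -[c t] _ /=.
by rewrite fgh ?size_tuple // scalerDr !scalerA mulrC.
Qed.

Lemma multilinear_comp n (V W : lmodType K) (f : seq H -> V) (g : V -> W) :
  linear g -> multilinear n f -> multilinear n (g \o f).
Proof. by move=> g_lin f_lin s1 s2 a x y sn /=; rewrite f_lin // g_lin. Qed.

Lemma linear_fun0 (V W : lmodType K) (f : V -> W) : linear f -> f 0 = 0.
Proof.
by move=> f_lin; have := f_lin (-1) 0 0; rewrite scaler0 addr0 scaleN1r addNr.
Qed.

Lemma tpow_ind n (P : tpow n -> Prop) :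
    (forall a s u, size s = n -> P u -> P (a *: pure n s + u)) -> P 0 ->
  forall u, P u.
Proof.
move=> PD P0 u; rewrite -[u]treprK -[trepr u]freeg_sumE.
elim: (dom _) => [|t r IHr]; first by rewrite big_nil tpi0.
rewrite big_cons pi_tpowD.
suff -> : << coeff t (trepr u) *g t >> = coeff t (trepr u) *: << t >>.
  rewrite pi_tpowZ -[t in << t >>]seq_tupleK; apply: PD => //.
  exact: size_tuple.
by apply/eqP/freeg_eqP => s; rewrite coeffZ !coeffU mul1r.
Qed.

Lemma tpow_eq_linear n (V : lmodType K) (f g : tpow n -> V) :
    linear f -> linear g ->
    (forall s, size s = n -> f (pure n s) = g (pure n s)) -> f =1 g.
Proof.
move=> f_lin g_lin fg; elim/tpow_ind => [a s u sn fgu|].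
  by rewrite f_lin g_lin fg // fgu.
have f0 h : linear h -> h 0 = 0 :> V.
  by move=> h_lin; have := h_lin (-1) 0 0; rewrite scaler0 addr0 scaleN1r addNr.
by rewrite !f0.
Qed.


(* [tlift2 f] sends a (x) b to [f a b]: the form in which Sweedler's notation
   is read, [tlift2 f (coprod h)] being the sum of the [f h_(1) h_(2)]. *)
Definition tlift2 (V : lmodType K) (f : H -> H -> V) (u : tpow 2) : V :=
  tlift (fun s => f s`_0 s`_1) u.

Lemma multilinear2 (V : lmodType K) (f : H -> H -> V) :
    (forall y, linear (f^~ y)) -> (forall x, linear (f x)) ->
  multilinear 2 (fun s => f s`_0 s`_1).
Proof.
move=> fl fr [|z [|? ?]] [|z' [|? ?]] a x y /= /eqP;
  rewrite ?(addSn, addnS, eqSS) // => _; [exact: fl | exact: fr].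
Qed.

Lemma tlift2_linear (V : lmodType K) (f : H -> H -> V) :
    (forall y, linear (f^~ y)) -> (forall x, linear (f x)) ->
  linear (tlift2 f).
Proof. by move=> fl fr; apply/tlift_linear/multilinear2. Qed.

Lemma tlift2_pure (V : lmodType K) (f : H -> H -> V) (x y : H) :
    (forall y, linear (f^~ y)) -> (forall x, linear (f x)) ->
  tlift2 f (pure 2 [:: x; y]) = f x y.
Proof. by move=> fl fr; rewrite /tlift2 tlift_pure //; apply: multilinear2. Qed.

Lemma tlift2_comb (V : lmodType K) (f g h : H -> H -> V) (a : K) (u : tpow 2) :
    (forall x y, f x y = a *: g x y + h x y) ->
  tlift2 f u = a *: tlift2 g u + tlift2 h u.
Proof. by move=> fgh; apply: tlift_comb => t _; apply: fgh. Qed.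

Lemma pure_linear n (s1 s2 : seq H) :
  (size s1 + (size s2).+1 = n)%N -> linear (fun x => pure n (s1 ++ x :: s2)).
Proof. by move=> sn a x y; apply: pure_multilinear. Qed.

Lemma tpow0_bij : bijective (fun a : K => a *: pure 0 [::]).
Proof.
have f_lin : multilinear 0 (fun _ : seq H => 1 : K^o) by move=> [|? ?] [|? ?] ? ? ? /= /eqP; rewrite ?(addSn, addnS, eqSS).
exists (tlift (fun _ : seq H => 1 : K^o) : tpow 0 -> K).
  move=> a; rewrite -[X in tlift _ X]addr0 (tlift_linear f_lin).
  rewrite tlift_pure // (linear_fun0 (tlift_linear f_lin)) addr0.
  exact: mulr1.
pose p (u : tpow 0) := tlift (fun _ => 1 : K^o) u *: pure 0 [::].
apply: (@tpow_eq_linear 0 _ p id) => [a u v||[|? ?] _] //; rewrite /p.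
  by rewrite (tlift_linear f_lin) scalerDl scalerA.
by rewrite tlift_pure // scale1r.
Qed.

Lemma tpow1_bij : bijective (fun h : H => pure 1 [:: h]).
Proof.
have f_lin : multilinear 1 (fun s : seq H => s`_0) by move=> [|? ?] [|? ?] ? ? ? /= /eqP; rewrite ?(addSn, addnS, eqSS).
exists (tlift (fun s : seq H => s`_0)) => [h|]; first by rewrite tlift_pure.
pose p (u : tpow 1) := pure 1 [:: tlift (fun s => s`_0) u].
apply: (@tpow_eq_linear 1 _ p id) => [a u v||[|h [|? ?]] // _] //; rewrite /p.
  by rewrite (tlift_linear f_lin) (@pure_linear 1 [::] [::]).
by rewrite tlift_pure.
Qed.

End TensorPower.

Section TensorAlgebra.
Variables (K : fieldType) (H : algType K).

Definition mul_seq (s t : seq H) : seq H := [seq p.1 * p.2 | p <- zip s t].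

(* Componentwise product: the product of s1 (x) .. (x) sn and t1 (x) .. (x) tn
   is s1 t1 (x) .. (x) sn tn. *)
Definition tmul n (u v : tpow H n) : tpow H n :=
  tlift (fun s => tlift (fun t => pure n (mul_seq s t)) v) u.

Lemma size_mul_seq s t : size s = size t -> size (mul_seq s t) = size s.
Proof. by move=> st; rewrite size_map size1_zip // st. Qed.

Lemma mul_seq_cat s1 s2 t1 t2 x y : size s1 = size t1 ->
  mul_seq (s1 ++ x :: s2) (t1 ++ y :: t2)
    = mul_seq s1 t1 ++ (x * y) :: mul_seq s2 t2.
Proof. by move=> st; rewrite /mul_seq zip_cat // map_cat. Qed.

Lemma split_seq (s : seq H) m1 m2 : size s = (m1 + m2.+1)%N ->
  exists s1 x s2, [/\ s = s1 ++ x :: s2, size s1 = m1 & size s2 = m2].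
Proof.
move=> sm; have m1s : (m1 < size s)%N by rewrite sm -addn1 leq_add2l.
exists (take m1 s), s`_m1, (drop m1.+1 s); split.
- by rewrite -drop_nth // cat_take_drop.
- by rewrite size_takel // ltnW.
- by rewrite size_drop sm -addSnnS addKn.
Qed.

Lemma mul_multilinearr n s : size s = n -> multilinear n (fun t => pure n (mul_seq s t)).
Proof.
move=> sn t1 t2 a x y tn; rewrite -tn in sn.
have [s1 [z [s2 [-> s1n s2n]]]] := split_seq sn.
rewrite !mul_seq_cat // mulrDr -scalerAr pure_multilinear //.
by rewrite !size_mul_seq // s1n s2n.
Qed.

Lemma mul_multilinearl n t : size t = n -> multilinear n (fun s => pure n (mul_seq s t)).
Proof.
move=> tn s1 s2 a x y sn; rewrite -sn in tn.
have [t1 [z [t2 [-> t1n t2n]]]] := split_seq tn.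
rewrite !mul_seq_cat // mulrDl -scalerAl pure_multilinear //.
by rewrite !size_mul_seq // s1n s2n.
Qed.

Lemma tmul_multilinear n (v : tpow H n) :
  multilinear n (fun s => tlift (fun t => pure n (mul_seq s t)) v).
Proof.
move=> s1 s2 a x y sn; apply: tlift_comb => t tn.
exact: (mul_multilinearl tn).
Qed.

Lemma tmul_linearl n (v : tpow H n) : linear (fun u => tmul u v).
Proof. exact/tlift_linear/tmul_multilinear. Qed.

Lemma tmul_linearr n (u : tpow H n) : linear (tmul u).
Proof.
move=> a v w; apply: tlift_comb => s sn.
exact: (tlift_linear (mul_multilinearr sn)).
Qed.

Lemma tmul_pure n s t : size s = n -> size t = n ->
  tmul (pure n s) (pure n t) = pure n (mul_seq s t).
Proof.
move=> sn tn; rewrite /tmul tlift_pure //; last exact: tmul_multilinear.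
by rewrite tlift_pure //; apply: mul_multilinearr.
Qed.

Definition tone n : tpow H n := pure n (nseq n 1).

Lemma linear_comp (U V W : lmodType K) (f : U -> V) (g : V -> W) :
  linear f -> linear g -> linear (fun u => g (f u)).
Proof. by move=> f_lin g_lin a u v; rewrite f_lin g_lin. Qed.

Lemma mul_seqA : associative mul_seq.
Proof.
move=> s; elim: s => [|x s IHs] [|y t] [|z r] //.
by rewrite /mul_seq /= mulrA -!/(mul_seq _ _) IHs.
Qed.

Lemma tmulA n : associative (@tmul n).
Proof.
move=> u v w.
move: u; apply: tpow_eq_linear.
- exact: tmul_linearl.
- exact: (linear_comp (tmul_linearl v) (tmul_linearl w)).
move=> s sn; move: v; apply: tpow_eq_linear.
- exact: (linear_comp (tmul_linearl w) (tmul_linearr _)).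
- exact: (linear_comp (tmul_linearr _) (tmul_linearl w)).
move=> t tn; move: w; apply: tpow_eq_linear.
- exact: (linear_comp (tmul_linearr _) (tmul_linearr _)).
- exact: tmul_linearr.
by move=> r rn; rewrite !tmul_pure ?size_mul_seq ?mul_seqA ?sn ?tn.
Qed.

Lemma tmul1 n : left_id (tone n) (@tmul n).
Proof.
apply: tpow_eq_linear => // [|s sn]; first exact: tmul_linearr.
rewrite tmul_pure ?size_nseq //; congr (pure n).
by rewrite -sn; elim: s {sn} => //= x s IHs; rewrite /mul_seq /= mul1r -/(mul_seq _ _) IHs.
Qed.

Lemma tmulr1 n : right_id (tone n) (@tmul n).
Proof.
apply: tpow_eq_linear => // [|s sn]; first exact: tmul_linearl.
rewrite tmul_pure ?size_nseq //; congr (pure n).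
by rewrite -sn; elim: s {sn} => //= x s IHs; rewrite /mul_seq /= mulr1 -/(mul_seq _ _) IHs.
Qed.

Lemma tmulDl n : left_distributive (@tmul n) +%R.
Proof. by move=> u v w; rewrite -[u]scale1r tmul_linearl !scale1r. Qed.

Lemma tmulDr n : right_distributive (@tmul n) +%R.
Proof. by move=> u v w; rewrite -[v]scale1r tmul_linearr !scale1r. Qed.

HB.instance Definition _ n := GRing.Zmodule_isPzRing.Build (tpow H n)
  (@tmulA n) (@tmul1 n) (@tmulr1 n) (@tmulDl n) (@tmulDr n).

End TensorAlgebra.

(* Axioms are written in Sweedler form, see [tlift2]. *)
Record hopf_structure (K : fieldType) (H : algType K) := HopfStructure {
  coprod : {linear H -> tpow H 2};
  counit : {lrmorphism H -> K^o};
  antipode : {linear H -> H};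
  coprod1 : coprod 1 = 1;
  coprodM : forall g h : H, coprod (g * h) = coprod g * coprod h;
  coprodA : forall h : H,
    tlift2 (fun a b => tlift2 (fun a1 a2 => pure 3 [:: a1; a2; b]) (coprod a))
      (coprod h) =
    tlift2 (fun a b => tlift2 (fun b1 b2 => pure 3 [:: a; b1; b2]) (coprod b))
      (coprod h);
  counitl : forall h : H, tlift2 (fun a b => counit a *: b) (coprod h) = h;
  counitr : forall h : H, tlift2 (fun a b => counit b *: a) (coprod h) = h;
  antipodel : forall h : H,
    tlift2 (fun a b => antipode a * b) (coprod h) = counit h *: 1;
  antipoder : forall h : H,
    tlift2 (fun a b => a * antipode b) (coprod h) = counit h *: 1
}.

Section HopfCyclic.
Variables (K : fieldType) (H : algType K) (A : hopf_structure H).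

Definition twisted_antipode (delta : H -> K) (h : H) : H :=
  tlift2 (fun a b => delta a *: antipode A b) (coprod A h).

Definition group_like (sigma : H) : Prop :=
  coprod A sigma = pure 2 [:: sigma; sigma] /\ counit A sigma = 1.

(* [H] carries no inversion, so sigma^-1 is given as the (necessarily unique)
   two-sided inverse [sigma']. *)
Definition modular_pair_in_involution (delta : {lrmorphism H -> K^o})
    (sigma : H) : Prop :=
  [/\ group_like sigma,
      delta sigma = 1 &
      exists sigma' : H,
        [/\ sigma' * sigma = 1, sigma * sigma' = 1 &
            forall h, sigma' * twisted_antipode delta
                        (sigma' * twisted_antipode delta h) = h]].

(* Applies the coproduct to the tensor factor with 0-based index j. *)
Definition coprod_at (n j : nat) (u : tpow H n) : tpow H n.+1 :=
  tlift (fun s => tlift2 (fun a b =>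
      pure n.+1 (take j s ++ [:: a, b & drop j.+1 s])) (coprod A s`_j)) u.

(* [iter_coprod k] maps H to its (k+1)-st tensor power. *)
Fixpoint iter_coprod (k : nat) (h : H) : tpow H k.+1 :=
  if k is k'.+1 then coprod_at 0 (iter_coprod k' h) else pure 1 [:: h].

(* The operators below are indexed by [nat]; [hopf_face sigma n i] and
   [hopf_degen n i] are relevant for i <= n.+1 and i <= n respectively. *)
Definition hopf_face (sigma : H) (n i : nat) (u : tpow H n) : tpow H n.+1 :=
  if i == 0%N then tlift (fun s => pure n.+1 (1 :: s)) u
  else if i == n.+1 then tlift (fun s => pure n.+1 (rcons s sigma)) u
  else coprod_at i.-1 u.

Definition hopf_degen (n i : nat) (u : tpow H n.+1) : tpow H n :=
  tlift (fun s => (counit A s`_i : K) *: pure n (take i s ++ drop i.+1 s)) u.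

Definition hopf_cyclic (delta : H -> K) (sigma : H) (n : nat) :
    tpow H n -> tpow H n :=
  if n is m.+1 then
    tlift (fun s => iter_coprod m (twisted_antipode delta s`_0)
                    * pure m.+1 (rcons (behead s) sigma))
  else id.

End HopfCyclic.

Record is_cocyclic_module (K : fieldType) (X : nat -> lmodType K)
    (d : forall n, nat -> X n -> X n.+1) (s : forall n, nat -> X n.+1 -> X n)
    (t : forall n, X n -> X n) : Prop := IsCocyclicModule {
  face_linear : forall n i, (i <= n.+1)%N -> linear (d n i);
  degen_linear : forall n i, (i <= n)%N -> linear (s n i);
  cyclic_linear : forall n, linear (t n);
  face_face : forall n i j x, (i < j <= n.+2)%N ->
    d n.+1 j (d n i x) = d n.+1 i (d n j.-1 x);
  degen_degen : forall n i j x, (i <= j <= n)%N ->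
    s n j (s n.+1 i x) = s n i (s n.+1 j.+1 x);
  degen_face_lt : forall n i j x, (i < j <= n.+1)%N ->
    s n.+1 j (d n.+1 i x) = d n i (s n j.-1 x);
  degen_face_id : forall n i j x, (j <= n)%N -> i = j \/ i = j.+1 ->
    s n j (d n i x) = x;
  degen_face_gt : forall n i j x, (j.+1 < i <= n.+2)%N ->
    s n.+1 j (d n.+1 i x) = d n i.-1 (s n j x);
  cyclic_face : forall n i x, (1 <= i <= n.+1)%N ->
    t n.+1 (d n i x) = d n i.-1 (t n x);
  cyclic_face0 : forall n x, t n.+1 (d n 0 x) = d n n.+1 x;
  cyclic_degen : forall n i x, (1 <= i <= n)%N ->
    t n (s n i x) = s n i.-1 (t n.+1 x);
  cyclic_degen0 : forall n x, t n (s n 0 x) = s n n (t n.+1 (t n.+1 x));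
  cyclic_order : forall n x, iter n.+1 (t n) x = x
}.

Section HopfCyclicTheory.
Variables (K : fieldType) (H : algType K) (A : hopf_structure H).

(* The sizes in a goal may be those of one sequence over two convertible but
   distinct forms of the carrier of [H]. *)
Local Ltac size_lia :=
  repeat match goal with
  | _ : context[@size ?T ?s] |- context[@size ?U ?s] =>
      tryif constr_eq T U then fail else change (@size U s) with (@size T s)
  end; lia.

Lemma nth_cat_mid (s1 s2 : seq H) x : (s1 ++ x :: s2)`_(size s1) = x.
Proof. by rewrite nth_cat ltnn subnn. Qed.

Lemma drop_cat_mid (s1 s2 : seq H) x :
  drop (size s1).+1 (s1 ++ x :: s2) = s2.
Proof. by rewrite -cat_rcons drop_size_cat ?size_rcons. Qed.

Lemma pure_lin n (l lx ly s1 s2 : seq H) (a : K) x y :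
    l = s1 ++ (a *: x + y) :: s2 -> lx = s1 ++ x :: s2 ->
    ly = s1 ++ y :: s2 -> (size s1 + (size s2).+1 = n)%N ->
  pure n l = a *: pure n lx + pure n ly.
Proof. by move=> -> -> ->; apply: pure_multilinear. Qed.

Lemma coprod_at_multilinear n j : (j < n)%N ->
  multilinear n (fun s => tlift2 (fun a b =>
      pure n.+1 (take j s ++ [:: a, b & drop j.+1 s])) (coprod A s`_j)).
Proof.
move=> jn s1 s2 a x y sn; case: (ltngtP j (size s1)) => [js1|s1j|->].
- set s := drop j.+1 s1.
  have dE z : drop j.+1 (s1 ++ z :: s2) = s ++ z :: s2.
    rewrite drop_cat /s; case: leqP => // ?.
    by rewrite (elimT eqP js1) drop0 drop_oversize.
  rewrite !nth_cat js1 !take_cat js1 !dE; apply: tlift2_comb => b c.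
  apply: (@pure_lin _ _ _ _ (take j s1 ++ [:: b, c & s]) s2 _ x y);
    rewrite -?catA //.
  by rewrite size_cat /= size_takel ?(ltnW js1) // /s size_drop; size_lia.
- have [k jk] : exists k, j = (size s1 + k.+1)%N.
    by exists (j - (size s1).+1)%N; lia.
  have tE z : take j (s1 ++ z :: s2) = s1 ++ z :: take k s2.
    by rewrite jk take_cat ltnNge leq_addr addKn.
  have dE z : drop j.+1 (s1 ++ z :: s2) = drop k.+1 s2.
    by rewrite jk -addnS drop_cat ltnNge leq_addr addKn.
  have nE z : (s1 ++ z :: s2)`_j = s2`_k.
    by rewrite jk nth_cat ltnNge leq_addr addKn.
  rewrite !tE !dE !nE; apply: tlift2_comb => b c.
  apply: (@pure_lin _ _ _ _ s1 (take k s2 ++ [:: b, c & drop k.+1 s2]) _ x y);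
    rewrite -?catA //.
  by rewrite size_cat /= size_takel ?size_drop; size_lia.
- rewrite !nth_cat_mid !take_size_cat // !drop_cat_mid linearP.
  apply: tlift2_linear => [c|b] {}a {}x {}y.
    by apply: (@pure_lin _ _ _ _ s1 (c :: s2)) => //=; size_lia.
  by apply: (@pure_lin _ _ _ _ (s1 ++ [:: b]) s2);
    rewrite -?catA // size_cat /=; size_lia.
Qed.

Lemma coprod_at_linear n j : (j < n)%N -> linear (@coprod_at K H A n j).
Proof. by move=> jn; apply/tlift_linear/coprod_at_multilinear. Qed.

Lemma coprod_at_pure n j s : size s = n -> (j < n)%N ->
  coprod_at A j (pure n s) =
    tlift2 (fun a b => pure n.+1 (take j s ++ [:: a, b & drop j.+1 s]))
      (coprod A s`_j).
Proof.
by move=> sn jn; rewrite /coprod_at tlift_pure //; apply: coprod_at_multilinear.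
Qed.

Lemma iter_coprod_linear k : linear (iter_coprod A k).
Proof.
elim: k => [|k IHk] a x y /=; first exact: (@pure_multilinear K H 1 [::] [::]).
by rewrite IHk coprod_at_linear.
Qed.

Lemma twisted_antipode_linear (delta : {linear H -> K^o}) :
  linear (twisted_antipode A delta).
Proof.
move=> a x y; rewrite /twisted_antipode linearP.
apply: tlift2_linear => [c|b] {}a {}x {}y.
  by rewrite linearP scalerDl scalerA.
by rewrite linearP scalerDr !scalerA mulrC.
Qed.

Variables (delta : {lrmorphism H -> K^o}) (sigma : H).

Lemma hopf_face0_pure n s : size s = n ->
  hopf_face A sigma 0 (pure n s) = pure n.+1 (1 :: s).
Proof.
move=> sn; rewrite /hopf_face /= tlift_pure // => s1 s2 a x y {}sn.
by apply: (@pure_lin _ _ _ _ (1 :: s1) s2) => //=; size_lia.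
Qed.

Lemma hopf_face_last_pure n s : size s = n ->
  hopf_face A sigma n.+1 (pure n s) = pure n.+1 (rcons s sigma).
Proof.
move=> sn; rewrite /hopf_face /= eqxx tlift_pure // => s1 s2 a x y {}sn.
by apply: (@pure_lin _ _ _ _ s1 (rcons s2 sigma)); 
  rewrite ?rcons_cat // size_rcons; size_lia.
Qed.

Lemma hopf_face_mid_pure n j s : size s = n -> (1 <= j <= n)%N ->
  hopf_face A sigma j (pure n s) =
    tlift2 (fun a b => pure n.+1 (take j.-1 s ++ [:: a, b & drop j s]))
      (coprod A s`_j.-1).
Proof.
case: j => // j sn /= jn; rewrite /hopf_face /= eqSS ltn_eqF //.
exact: coprod_at_pure.
Qed.

Lemma hopf_degen_multilinear n i : (i <= n)%N ->
  multilinear n.+1 (fun s : seq H =>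
    (counit A s`_i : K) *: pure n (take i s ++ drop i.+1 s)).
Proof.
move=> jn s1 s2 a x y sn; case: (ltngtP i (size s1)) => [js1|s1j|->].
- set s := drop i.+1 s1.
  have dE z : drop i.+1 (s1 ++ z :: s2) = s ++ z :: s2.
    rewrite drop_cat /s; case: leqP => // ?.
    by rewrite (elimT eqP js1) drop0 drop_oversize.
  rewrite !nth_cat js1 !take_cat js1 !dE.
  rewrite scalerA [a * _]mulrC -scalerA -scalerDr; congr (_ *: _).
  apply: (@pure_lin _ _ _ _ (take i s1 ++ s) s2 _ x y);
    rewrite -?catA //.
  by rewrite size_cat /= size_takel ?(ltnW js1) // /s size_drop; size_lia.
- have [k jk] : exists k, i = (size s1 + k.+1)%N.
    by exists (i - (size s1).+1)%N; lia.
  have tE z : take i (s1 ++ z :: s2) = s1 ++ z :: take k s2.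
    by rewrite jk take_cat ltnNge leq_addr addKn.
  have dE z : drop i.+1 (s1 ++ z :: s2) = drop k.+1 s2.
    by rewrite jk -addnS drop_cat ltnNge leq_addr addKn.
  have nE z : (s1 ++ z :: s2)`_i = s2`_k.
    by rewrite jk nth_cat ltnNge leq_addr addKn.
  rewrite !tE !dE !nE.
  rewrite scalerA [a * _]mulrC -scalerA -scalerDr; congr (_ *: _).
  apply: (@pure_lin _ _ _ _ s1 (take k s2 ++ drop k.+1 s2) _ x y);
    rewrite -?catA //.
  by rewrite size_cat /= size_takel ?size_drop; size_lia.
- rewrite !nth_cat_mid !take_size_cat // !drop_cat_mid linearP.
  by rewrite scalerDl scalerA.
Qed.

Lemma hopf_degen_pure n i s : size s = n.+1 -> (i <= n)%N ->
  hopf_degen A i (pure n.+1 s) =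
    (counit A s`_i : K) *: pure n (take i s ++ drop i.+1 s).
Proof.
by move=> sn lt_in; rewrite /hopf_degen tlift_pure //; apply: hopf_degen_multilinear.
Qed.

Lemma hopf_cyclic_multilinear n :
  multilinear n.+1 (fun s : seq H => iter_coprod A n (twisted_antipode A delta s`_0)
     * pure n.+1 (rcons (behead s) sigma)).
Proof.
move=> [|z s1] s2 a x y sn /=.
  rewrite twisted_antipode_linear iter_coprod_linear; exact: tmul_linearl.
rewrite -(tmul_linearr _ a); congr (_ * _).
by apply: (@pure_lin _ _ _ _ s1 (rcons s2 sigma));
  rewrite ?rcons_cat // size_rcons; move: sn => /=; size_lia.
Qed.

Lemma hopf_cyclic_pure n h s : size s = n ->
  hopf_cyclic A delta sigma (pure n.+1 (h :: s)) =
    iter_coprod A n (twisted_antipode A delta h) * pure n.+1 (rcons s sigma).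
Proof.
move=> sn; rewrite /hopf_cyclic tlift_pure //; last by rewrite /= sn.
exact: hopf_cyclic_multilinear.
Qed.

End HopfCyclicTheory.

(* Main.v *)
(* Write St for the twisted antipode.  H acts diagonally on H^(n+1), and
   [h0 ; h1 .. hn] |-> St(h0).(h1 .. hn) identifies the coinvariants of that
   action twisted by delta with H^n.  Under this map the cyclic operator becomes
   the rotation [h0 ; h1 .. hn] |-> [h1 ; h2 .. hn, sigma h0]: this follows from
     sum St(g1).(g2.y (x) z) = y (x) St(g) z
   together with St(St(h)) sigma = sigma h, which is the involution condition.
   Hence tau^(n+1) is the diagonal action of sigma, trivial since
   St(sigma) sigma = 1; and tau^2 puts sigma h1 in the last slot, where the
   counit removes it, which is the relation between tau and sigma_0.  The other
   identities are checked on tensors a (x) u, one tensor factor at a time. *)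
Require Import Defs.
From mathcomp Require Import all_boot all_order all_algebra.
From mathcomp Require Import reals complex zify.

Set Implicit Arguments.
Unset Strict Implicit.
Unset Printing Implicit Defensive.

Import GRing.Theory.
Local Open Scope ring_scope.

(** * Adjoining a tensor factor in front or at the end; closure rules for linear maps *)

Section TensorCons.
Variables (K : fieldType) (H : lmodType K).

Definition tcons n (a : H) (u : tpow H n) : tpow H n.+1 :=
  tlift (fun s => pure n.+1 (a :: s)) u.

Definition trcons n (u : tpow H n) (z : H) : tpow H n.+1 :=
  tlift (fun s => pure n.+1 (rcons s z)) u.

Lemma cons_multilinear n a : multilinear n (fun s : seq H => pure n.+1 (a :: s)).
Proof.
by move=> s1 s2 c x y sn; rewrite -!cat_cons pure_multilinear //= addSn sn.
Qed.

Lemma rcons_multilinear n z :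
  multilinear n (fun s : seq H => pure n.+1 (rcons s z)).
Proof.
move=> s1 s2 c x y sn; rewrite !rcons_cat !rcons_cons pure_multilinear //.
by rewrite size_rcons addnS sn.
Qed.

Lemma tcons_pure n a s : size s = n -> tcons a (pure n s) = pure n.+1 (a :: s).
Proof. by move=> sn; rewrite /tcons tlift_pure //; apply: cons_multilinear. Qed.

Lemma trcons_pure n s z : size s = n ->
  trcons (pure n s) z = pure n.+1 (rcons s z).
Proof. by move=> sn; rewrite /trcons tlift_pure //; apply: rcons_multilinear. Qed.

Lemma tcons_linearr n a : linear (@tcons n a).
Proof. exact/tlift_linear/cons_multilinear. Qed.

Lemma trcons_linearl n z : linear (fun u : tpow H n => trcons u z).
Proof. exact/tlift_linear/rcons_multilinear. Qed.

Lemma tcons_linearl n (u : tpow H n) : linear (fun a => tcons a u).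
Proof.
move=> c x y; apply: tlift_comb => s sn.
by rewrite (@pure_multilinear _ _ _ [::]) //= sn.
Qed.

Lemma trcons_linearr n (u : tpow H n) : linear (trcons u).
Proof.
move=> c x y; apply: tlift_comb => s sn.
by rewrite -!cats1 pure_multilinear //= addn1 sn.
Qed.

(** Only the first factor is separated and [u] stays an arbitrary tensor, so an induction hypothesis
    on [tpow H n] applies to it directly. *)
Lemma tpowS_eq n (V : lmodType K) (f g : tpow H n.+1 -> V) :
  linear f -> linear g -> (forall a u, f (tcons a u) = g (tcons a u)) -> f =1 g.
Proof.
move=> f_lin g_lin fg; apply: tpow_eq_linear => // -[|a s] //= [sn].
by rewrite -tcons_pure.
Qed.

Lemma tpow0_eq (V : lmodType K) (f g : tpow H 0 -> V) :
  linear f -> linear g -> f (pure 0 [::]) = g (pure 0 [::]) -> f =1 g.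
Proof. by move=> f_lin g_lin fg; apply: tpow_eq_linear => // -[]. Qed.

(** The lemmas named [lin_] are closure rules, one for each operation; the tactic [lin] chains them
    to discharge linearity side conditions. *)
Lemma lin_id (V : lmodType K) : linear (fun x : V => x).
Proof. by []. Qed.

Lemma lin_scale (U V : lmodType K) (f : U -> V) c :
  linear f -> linear (fun x => c *: f x).
Proof. by move=> f_lin a x y; rewrite f_lin scalerDr !scalerA mulrC. Qed.

Lemma lin_scalar (U V : lmodType K) (f : U -> K^o) (v : V) :
  linear f -> linear (fun x => (f x : K) *: v).
Proof. by move=> f_lin a x y; rewrite f_lin scalerDl scalerA. Qed.

Lemma lin_tconsl n (V : lmodType K) (f : V -> H) (u : tpow H n) :
  linear f -> linear (fun x => tcons (f x) u).
Proof. by move=> f_lin; apply: (linear_comp f_lin (tcons_linearl u)). Qed.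

Lemma lin_tconsr n (V : lmodType K) (f : V -> tpow H n) a :
  linear f -> linear (fun x => tcons a (f x)).
Proof. by move=> f_lin; apply: (linear_comp f_lin (tcons_linearr a)). Qed.

Lemma lin_trconsl n (V : lmodType K) (f : V -> tpow H n) z :
  linear f -> linear (fun x => trcons (f x) z).
Proof. by move=> f_lin; apply: (linear_comp f_lin (trcons_linearl z)). Qed.

Lemma lin_trconsr n (V : lmodType K) (f : V -> H) (u : tpow H n) :
  linear f -> linear (fun x => trcons u (f x)).
Proof. by move=> f_lin; apply: (linear_comp f_lin (trcons_linearr u)). Qed.

Lemma linZ (V W : lmodType K) (f : V -> W) c x : linear f -> f (c *: x) = c *: f x.
Proof. by move=> f_lin; rewrite -[c *: x]addr0 f_lin linear_fun0 // addr0. Qed.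

(** [tlift] evaluates [f] on the chosen representative [trepr u], hence is a finite sum; linear maps
    and other such sums then commute with it for arbitrary [f]. *)
Lemma tlift_sum n (V : lmodType K) (f : seq H -> V) (u : tpow H n) :
  tlift f u = \sum_(x <- freeg.fgenum (trepr u)) x.1 *: f x.2.
Proof.
by rewrite /tlift -[in LHS](freeg.Freeg_enum (trepr u)) !freeg.fglift_Freeg.
Qed.

Lemma tlift_lin n (V W : lmodType K) (g : V -> W) (f : seq H -> V) (u : tpow H n) :
  linear g -> g (tlift f u) = tlift (fun s => g (f s)) u.
Proof.
move=> g_lin; rewrite !tlift_sum; elim: (freeg.fgenum _) => [|[c t] r IHr].
  by rewrite !big_nil linear_fun0.
by rewrite !big_cons g_lin IHr.
Qed.

End TensorCons.

(** * The componentwise product, one tensor factor at a time *)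

Section TensorMul.
Variables (K : fieldType) (H : algType K).

Lemma lin_mull (V : lmodType K) (f : V -> H) (z : H) :
  linear f -> linear (fun x => f x * z).
Proof. by move=> f_lin a x y; rewrite f_lin mulrDl scalerAl. Qed.

Lemma lin_mulr (V : lmodType K) (f : V -> H) (z : H) :
  linear f -> linear (fun x => z * f x).
Proof. by move=> f_lin a x y; rewrite f_lin mulrDr scalerAr. Qed.

Lemma lin_tmull n (V : lmodType K) (f : V -> tpow H n) (v : tpow H n) :
  linear f -> linear (fun x => f x * v).
Proof. by move=> f_lin; apply: (linear_comp f_lin (tmul_linearl v)). Qed.

Lemma lin_tmulr n (V : lmodType K) (f : V -> tpow H n) (v : tpow H n) :
  linear f -> linear (fun x => v * f x).
Proof. by move=> f_lin; apply: (linear_comp f_lin (tmul_linearr v)). Qed.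

Lemma tcons_mul n a b (u v : tpow H n) :
  tcons a u * tcons b v = tcons (a * b) (u * v).
Proof.
move: u; apply: tpow_eq_linear => [||s sn].
- exact/lin_tmull/lin_tconsr/lin_id.
- exact/lin_tconsr/lin_tmull/lin_id.
move: v; apply: tpow_eq_linear => [||t tn].
- exact/lin_tmulr/lin_tconsr/lin_id.
- exact/lin_tconsr/lin_tmulr/lin_id.
have st : size s = size t by rewrite sn tn.
rewrite !tcons_pure // [LHS]tmul_pure ?[X in tcons _ X]tmul_pure //= ?sn ?tn //.
by rewrite tcons_pure // size_mul_seq.
Qed.

Lemma trcons_tcons n a (u : tpow H n) z :
  trcons (tcons a u) z = tcons a (trcons u z).
Proof.
move: u; apply: tpow_eq_linear => [||s sn].
- exact/lin_trconsl/lin_tconsr/lin_id.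
- exact/lin_tconsr/lin_trconsl/lin_id.
by rewrite tcons_pure // !trcons_pure ?tcons_pure ?size_rcons //= sn.
Qed.

(** Tensors are taken apart at the front only, so a rule for the last factor needs induction on [n],
    with [trcons_tcons] carrying the last factor past the first. *)
Lemma trcons_mul n (u v : tpow H n) y z :
  trcons u y * trcons v z = trcons (u * v) (y * z).
Proof.
elim: n u v => [|n IHn] u v; last first.
  move: u; apply: tpowS_eq => [||a u].
  - exact/lin_tmull/lin_trconsl/lin_id.
  - exact/lin_trconsl/lin_tmull/lin_id.
  move: v; apply: tpowS_eq => [||b v].
  - exact/lin_tmulr/lin_trconsl/lin_id.
  - exact/lin_trconsl/lin_tmulr/lin_id.
  by rewrite !trcons_tcons !tcons_mul IHn trcons_tcons.
move: u; apply: tpow0_eq.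
- exact/lin_tmull/lin_trconsl/lin_id.
- exact/lin_trconsl/lin_tmull/lin_id.
move: v; apply: tpow0_eq.
- exact/lin_tmulr/lin_trconsl/lin_id.
- exact/lin_trconsl/lin_tmulr/lin_id.
(* [pure 0 [::]] is the unit of H^0. *)
rewrite [X in trcons X (_ * _)]mul1r.
by rewrite !trcons_pure // [LHS]tmul_pure.
Qed.

Lemma tcons11 n : tcons 1 (1 : tpow H n) = 1.
Proof. by rewrite tcons_pure // size_nseq. Qed.

End TensorMul.

(** * Calculus of Sweedler sums for arbitrary multilinear expressions *)

Section Sweedler.
Variables (K : fieldType) (H : algType K) (A : hopf_structure H).

Definition sweedler (V : lmodType K) (h : H) (f : H -> H -> V) : V :=
  tlift2 f (coprod A h).

Lemma sweedler_map (V W : lmodType K) (g : V -> W) h (f : H -> H -> V) :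
  linear g -> g (sweedler h f) = sweedler h (fun a b => g (f a b)).
Proof. exact: tlift_lin. Qed.

Lemma eq_sweedler (V : lmodType K) h (f g : H -> H -> V) :
  (forall a b, f a b = g a b) -> sweedler h f = sweedler h g.
Proof. by move=> fg; congr sweedler; do 2!apply: boolp.funext => ?. Qed.

Lemma lin_sweedler (U V : lmodType K) h (f : U -> H -> H -> V) :
  (forall a b, linear (fun x => f x a b)) -> linear (fun x => sweedler h (f x)).
Proof. by move=> f_lin c x y; apply: tlift2_comb => a b; apply: f_lin. Qed.

Lemma lin_sweedler_arg (U V : lmodType K) (k : U -> H) (f : H -> H -> V) :
    (forall b, linear (f^~ b)) -> (forall a, linear (f a)) -> linear k ->
  linear (fun x => sweedler (k x) f).
Proof.
by move=> fl fr k_lin c x y; rewrite /sweedler k_lin linearP tlift2_linear.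
Qed.

Lemma exchange_sweedler (V : lmodType K) g h (f : H -> H -> H -> H -> V) :
  sweedler g (fun a b => sweedler h (f a b)) =
  sweedler h (fun c d => sweedler g (fun a b => f a b c d)).
Proof.
rewrite /sweedler /tlift2 !tlift_sum.
under eq_bigr do rewrite tlift_sum scaler_sumr.
under [RHS]eq_bigr do rewrite tlift_sum scaler_sumr.
rewrite exchange_big; apply: eq_bigr => x _; apply: eq_bigr => y _.
by rewrite !scalerA mulrC.
Qed.

Lemma sweedlerZ (V : lmodType K) h (f : H -> H -> V) c :
  c *: sweedler h f = sweedler h (fun a b => c *: f a b).
Proof. exact/(sweedler_map (g := fun v => c *: v))/lin_scale/lin_id. Qed.

(** The axiom [coprodA] is the case of the universal trilinear map into H^3; applying the linear
    extension of [f] to it gives the general case. *)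
Lemma sweedlerA (V : lmodType K) (f : H -> H -> H -> V) h :
    (forall b c, linear (fun a => f a b c)) ->
    (forall a c, linear (fun b => f a b c)) ->
    (forall a b, linear (f a b)) ->
  sweedler h (fun a c => sweedler a (fun a1 a2 => f a1 a2 c)) =
  sweedler h (fun a b => sweedler b (fun b1 b2 => f a b1 b2)).
Proof.
move=> f1 f2 f3; pose F (s : seq H) := f s`_0 s`_1 s`_2.
have F_lin : multilinear 3 F.
  move=> [|z [|t [|? ?]]] [|z' [|t' [|? ?]]] a x y /= /eqP;
    rewrite ?(addSn, addnS, eqSS) // => _; [exact: f1 | exact: f2 | exact: f3].
have G_lin := tlift_linear F_lin.
have E : sweedler h (fun a b => sweedler a (fun a1 a2 => pure 3 [:: a1; a2; b])) =
    sweedler h (fun a b => sweedler b (fun b1 b2 => pure 3 [:: a; b1; b2])).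
  exact: coprodA A h.
move/(congr1 (tlift F)): E; rewrite !(sweedler_map _ _ G_lin).
under eq_sweedler => a c do rewrite (sweedler_map _ _ G_lin).
under [RHS]eq_sweedler => a c do rewrite (sweedler_map _ _ G_lin).
under eq_sweedler => a c.
  under eq_sweedler => ? ? do rewrite tlift_pure //.
  over.
under [RHS]eq_sweedler => a c.
  under eq_sweedler => ? ? do rewrite tlift_pure //.
  over.
by [].
Qed.

Lemma sweedlerM (V : lmodType K) (f : H -> H -> V) g h :
    (forall b, linear (f^~ b)) -> (forall a, linear (f a)) ->
  sweedler (g * h) f =
  sweedler g (fun a b => sweedler h (fun c d => f (a * c) (b * d))).
Proof.
move=> fl fr; have f_lin := tlift2_linear fl fr.
rewrite {1}/sweedler coprodM.
(* Arbitrary [u] and [v] replace the two coproducts, so that both can be reduced to elementary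
   tensors. *)
suff E (u v : tpow H 2) : tlift2 f (u * v) =
    tlift2 (fun a b => tlift2 (fun c d => f (a * c) (b * d)) v) u.
  by rewrite E.
have B1 a b d : linear (fun c => f (a * c) (b * d)).
  exact: (linear_comp (lin_mulr a (@lin_id _ H)) (fl (b * d))).
have B2 a b c : linear (fun d => f (a * c) (b * d)).
  exact: (linear_comp (lin_mulr b (@lin_id _ H)) (fr (a * c))).
have B3 b c d : linear (fun a => f (a * c) (b * d)).
  exact: (linear_comp (lin_mull c (@lin_id _ H)) (fl (b * d))).
have B4 a c d : linear (fun b => f (a * c) (b * d)).
  exact: (linear_comp (lin_mull d (@lin_id _ H)) (fr (a * c))).
have L w b : linear (fun a => tlift2 (fun c d => f (a * c) (b * d)) w).
  by move=> k x y; apply: tlift2_comb => c d; apply: B3.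
have R w a : linear (fun b => tlift2 (fun c d => f (a * c) (b * d)) w).
  by move=> k x y; apply: tlift2_comb => c d; apply: B4.
move: u; apply: tpow_eq_linear.
- exact: (linear_comp (tmul_linearl v) f_lin).
- exact: tlift2_linear.
move=> [|a [|b []]] // _; move: v; apply: tpow_eq_linear.
- exact: (linear_comp (tmul_linearr _) f_lin).
- by move=> k x y; apply: tlift2_comb => a' b'; apply: tlift2_linear.
move=> [|c [|d []]] // _.
by rewrite [X in tlift2 f X]tmul_pure // !tlift2_pure.
Qed.

Lemma sweedler1 (V : lmodType K) (f : H -> H -> V) :
    (forall b, linear (f^~ b)) -> (forall a, linear (f a)) ->
  sweedler 1 f = f 1 1.
Proof. by move=> fl fr; rewrite /sweedler coprod1 tlift2_pure. Qed.

Lemma sweedler_counitl (V : lmodType K) (f : H -> V) h :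
  linear f -> sweedler h (fun a b => (counit A a : K) *: f b) = f h.
Proof.
move=> f_lin; rewrite -[in RHS](counitl A h) -/(sweedler _ _).
rewrite (sweedler_map _ _ f_lin); apply: eq_sweedler => a b.
by rewrite linZ.
Qed.

Lemma sweedler_counitr (V : lmodType K) (f : H -> V) h :
  linear f -> sweedler h (fun a b => (counit A b : K) *: f a) = f h.
Proof.
move=> f_lin; rewrite -[in RHS](counitr A h) -/(sweedler _ _).
rewrite (sweedler_map _ _ f_lin); apply: eq_sweedler => a b.
by rewrite linZ.
Qed.

Lemma sweedler_antipodel (V : lmodType K) (f : H -> V) h :
  linear f -> sweedler h (fun a b => f (antipode A a * b)) = (counit A h : K) *: f 1.
Proof.
move=> f_lin; rewrite -(sweedler_map _ _ f_lin) -linZ //; congr f.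
exact: antipodel.
Qed.

Lemma sweedler_antipoder (V : lmodType K) (f : H -> V) h :
  linear f -> sweedler h (fun a b => f (a * antipode A b)) = (counit A h : K) *: f 1.
Proof.
move=> f_lin; rewrite -(sweedler_map _ _ f_lin) -linZ //; congr f.
exact: antipoder.
Qed.

Lemma lin_antipode (V : lmodType K) (k : V -> H) : linear k ->
  linear (fun x => antipode A (k x)).
Proof. by move=> k_lin a x y; rewrite k_lin linearP. Qed.

End Sweedler.

(** * Linearity of the operators, and the iterated coproduct including H^0 *)

Section Linearity.
Variables (K : fieldType) (H : algType K) (A : hopf_structure H).

Lemma lin_coprod_at n j (V : lmodType K) (f : V -> tpow H n) :
  (j < n)%N -> linear f -> linear (fun x => coprod_at A j (f x)).
Proof.
by move=> jn f_lin; apply: (linear_comp f_lin (coprod_at_linear A jn)).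
Qed.

Lemma hopf_degen_linear n i : (i <= n)%N -> linear (@hopf_degen K H A n i).
Proof. by move=> le_in; apply/tlift_linear/hopf_degen_multilinear. Qed.

Lemma lin_degen n i (V : lmodType K) (f : V -> tpow H n.+1) :
  (i <= n)%N -> linear f -> linear (fun x => hopf_degen A i (f x)).
Proof.
by move=> le_in f_lin; apply: (linear_comp f_lin (hopf_degen_linear le_in)).
Qed.

Lemma lin_lrmorphism (delta : {lrmorphism H -> K^o}) (V : lmodType K)
    (f : V -> H) :
  linear f -> linear (fun x => delta (f x) : K^o).
Proof. by move=> f_lin a x y; rewrite f_lin linearP. Qed.

(* The iterated coproduct H -> H^n (Delta^(n-1)), extended by the counit at
   [n = 0] so that the recursions below hold without restriction on [n]. *)
Definition tcoprod n (h : H) : tpow H n :=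
  if n is k.+1 then iter_coprod A k h else (counit A h : K) *: pure 0 [::].

Lemma tcoprod_linear n : linear (tcoprod n).
Proof.
case: n => [|n]; last exact: iter_coprod_linear.
exact/lin_scalar/lin_lrmorphism/lin_id.
Qed.

Lemma lin_tcoprod n (V : lmodType K) (f : V -> H) :
  linear f -> linear (fun x => tcoprod n (f x)).
Proof. by move=> f_lin; apply: (linear_comp f_lin (@tcoprod_linear n)). Qed.

Lemma lin_twisted (delta : {lrmorphism H -> K^o}) (V : lmodType K)
    (f : V -> H) :
  linear f -> linear (fun x => twisted_antipode A delta (f x)).
Proof.
by move=> f_lin; apply: (linear_comp f_lin (twisted_antipode_linear A delta)).
Qed.

End Linearity.

(* The inner matches [fun _ => ?c] detect that a factor does not depend on the
   variable, which tells in which argument linearity is wanted. *)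
Ltac lin := intros; lazymatch goal with
  | |- GRing.linear_for _ (fun x => x) => exact: lin_id
  | |- GRing.linear_for _ (fun x => GRing.Linear.sort (antipode _) _) =>
      apply: lin_antipode; lin
  | |- GRing.linear_for _ (fun x => _ *: (@?v x)) =>
      lazymatch v with
      | (fun _ => ?c) => apply: lin_scalar
      | _ => apply: lin_scale
      end; lin
  | |- GRing.linear_for _ (fun x => _ * (@?v x)) =>
      lazymatch v with
      | (fun _ => ?c) => first [apply: lin_mull | apply: lin_tmull]
      | _ => first [apply: lin_mulr | apply: lin_tmulr]
      end; lin
  | |- GRing.linear_for _ (fun x => tcons _ (@?v x)) =>
      lazymatch v with
      | (fun _ => ?c) => apply: lin_tconsl
      | _ => apply: lin_tconsr
      end; lin
  | |- GRing.linear_for _ (fun x => trcons _ (@?v x)) =>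
      lazymatch v with
      | (fun _ => ?c) => apply: lin_trconsl
      | _ => apply: lin_trconsr
      end; lin
  | |- GRing.linear_for _ (fun x => sweedler _ (@?h x) _) =>
      lazymatch h with
      | (fun _ => ?c) => apply: lin_sweedler
      | _ => apply: lin_sweedler_arg
      end; lin
  | |- GRing.linear_for _ (fun x => tcoprod _ _ _) => apply: lin_tcoprod; lin
  | |- GRing.linear_for _ (fun x => twisted_antipode _ _ _) =>
      apply: lin_twisted; lin
  | |- GRing.linear_for _ (fun x => GRing.LRMorphism.sort _ _) =>
      apply: lin_lrmorphism; lin
  | |- GRing.linear_for _ (fun x => coprod_at _ _ _) => apply: lin_coprod_at; lin
  | |- GRing.linear_for _ (fun x => hopf_degen _ _ _) => apply: lin_degen; lin
  | |- GRing.linear_for _ (tcons _) => exact: tcons_linearr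
  | |- GRing.linear_for _ (trcons _) => exact: trcons_linearr
  | |- GRing.linear_for _ (GRing.mul ?v) =>
      first [exact: (lin_mulr v (@lin_id _ _)) | exact: tmul_linearr]
  | |- GRing.linear_for _ (GRing.scale _) =>
      by move=> ? ? ?; rewrite scalerDr !scalerA mulrC
  | |- GRing.linear_for _ (GRing.LRMorphism.sort _) => exact: linearP
  | |- GRing.linear_for _ (GRing.Linear.sort _) => exact: linearP
  | |- GRing.linear_for _ (tcoprod _ _) => exact: tcoprod_linear
  | |- GRing.linear_for _ (twisted_antipode _ _) => apply: lin_twisted; lin
  | |- GRing.linear_for _ (coprod_at _ _) => apply: coprod_at_linear; lin
  | |- GRing.linear_for _ (hopf_degen _ _) => apply: hopf_degen_linear; lin
  | |- GRing.linear_for _ _ => solve [auto]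
  | |- _ => first [done | lia]
  end.

(** * The antipode is an anti-homomorphism for the product *)

Section Antipode.
Variables (K : fieldType) (H : algType K) (A : hopf_structure H).
Local Notation Sw := (sweedler A).
Local Notation S := (antipode A).

(* Both sides equal the sum of the S(g1 h1) g2 h2 S(h3) S(g3). *)
Lemma antipodeM g h : S (g * h) = S h * S g.
Proof.
transitivity (Sw g (fun p e => Sw h (fun q f => Sw p (fun a b =>
    Sw q (fun c d => S (a * c) * (b * d) * (S f * S e)))))).
  (* Left side: insert eps(g2) = sum g2 S(g3) after S(g1 h), then eps(h2) = sum h2 S(h3) between g2
     and S(g3). *)
  transitivity (Sw g (fun a t => Sw t (fun b e => Sw h (fun c w =>
      Sw w (fun d f => S (a * c) * (b * (d * S f) * S e)))))).
    transitivity (Sw g (fun a t => (counit A t : K) *: S (a * h))).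
      by rewrite sweedler_counitr //; lin.
    apply: eq_sweedler => a t.
    transitivity (Sw t (fun b e => S (a * h) * (b * S e))).
      by rewrite (sweedler_antipoder _ t (f := fun x => S (a * h) * x)) ?mulr1 //; lin.
    apply: eq_sweedler => b e.
    transitivity (Sw h (fun c w => (counit A w : K) *: (S (a * c) * (b * S e)))).
      by rewrite (sweedler_counitr _ (f := fun c => S (a * c) * (b * S e))) //; lin.
    apply: eq_sweedler => c w.
    by rewrite (sweedler_antipoder _ w (f := fun x => S (a * c) * (b * x * S e)))
      ?mulr1 //; lin.
  rewrite -(sweedlerA _ (f := fun a b e => Sw h (fun c w =>
    Sw w (fun d f => S (a * c) * (b * (d * S f) * S e))))); try by lin.
  apply: eq_sweedler => p e.
  rewrite [RHS]exchange_sweedler; apply: eq_sweedler => a b.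
  rewrite -(sweedlerA _ (f := fun c d f => S (a * c) * (b * (d * S f) * S e)));
    try by lin.
  by apply: eq_sweedler => q f; apply: eq_sweedler => c d; rewrite !mulrA.
(* Right side: with p and q the first legs of g and h, the sum of the S(a c) b d is the left
   antipode axiom at [p * q], giving eps(p) eps(q). *)
transitivity (Sw g (fun p e => (counit A p : K) *: (S h * S e))); last first.
  by rewrite (sweedler_counitl _ _ (f := fun e => S h * S e)) //; lin.
apply: eq_sweedler => p e.
transitivity (Sw h (fun q f => (counit A q : K) *: ((counit A p : K) *: (S f * S e)))).
  apply: eq_sweedler => q f.
  rewrite -(sweedlerM A p q (f := fun x y => S x * y * (S f * S e))); try by lin.
  rewrite (sweedler_antipodel _ (p * q) (f := fun x => x * (S f * S e))); last by lin.
  by rewrite mul1r rmorphM /= mulrC scalerA.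
by rewrite (sweedler_counitl _ _ (f := fun f => (counit A p : K) *: (S f * S e))) //; lin.
Qed.

End Antipode.

(** * Recursive description of the coproduct and the counit in a given slot *)

Section TensorOperators.
Variables (K : fieldType) (H : algType K) (A : hopf_structure H).
Local Notation Sw := (sweedler A).

Lemma coprod_at_pureE n j s : size s = n -> (j < n)%N ->
  coprod_at A j (pure n s) =
    Sw s`_j (fun a b => pure n.+1 (take j s ++ [:: a, b & drop j.+1 s])).
Proof. exact: coprod_at_pure. Qed.

(** This rule and the next three replace the [take] and [drop] formulas by a recursion on the first
    factor, on which the later inductions rest. *)
Lemma coprod_at0_tcons n a (u : tpow H n) :
  coprod_at A 0 (tcons a u) = Sw a (fun b c => tcons b (tcons c u)).
Proof.
move: u; apply: tpow_eq_linear => [||s sn]; [by lin | by lin|].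
rewrite tcons_pure // coprod_at_pureE //= ?sn // drop0.
by apply: eq_sweedler => b c; rewrite !tcons_pure //= sn.
Qed.

Lemma coprod_atS_tcons n j a (u : tpow H n) : (j < n)%N ->
  coprod_at A j.+1 (tcons a u) = tcons a (coprod_at A j u).
Proof.
move=> jn; move: u; apply: tpow_eq_linear => [||s sn]; [by lin | by lin|].
rewrite tcons_pure // !coprod_at_pureE //= ?sn //.
rewrite [RHS](sweedler_map _ _ _ (tcons_linearr a)).
apply: eq_sweedler => b c; rewrite tcons_pure // size_cat /= size_take size_drop.
by rewrite sn jn; lia.
Qed.

Lemma degen0_tcons n a (u : tpow H n) :
  hopf_degen A 0 (tcons a u) = (counit A a : K) *: u.
Proof.
move: u; apply: tpow_eq_linear => [||s sn]; [by lin | by lin|].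
by rewrite tcons_pure // hopf_degen_pure //= ?drop0 ?sn.
Qed.

Lemma degenS_tcons n i a (u : tpow H n.+1) : (i <= n)%N ->
  hopf_degen A i.+1 (tcons a u) = tcons a (hopf_degen A i u).
Proof.
move=> le_in; move: u; apply: tpow_eq_linear => [||s sn]; [by lin | by lin|].
rewrite tcons_pure // !hopf_degen_pure //= ?sn // (linZ _ _ (tcons_linearr a)).
by rewrite tcons_pure // size_cat size_take size_drop sn ltnS le_in; lia.
Qed.

Lemma coprod_at_trcons n j (u : tpow H n) z : (j < n)%N ->
  coprod_at A j (trcons u z) = trcons (coprod_at A j u) z.
Proof.
elim: n j u => [|n IHn] j u // jn.
move: u; apply: tpowS_eq => [||a u]; [by lin | by lin | ].
case: j jn => [|j] jn.
  rewrite trcons_tcons !coprod_at0_tcons.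
  rewrite (sweedler_map _ _ _ (trcons_linearl z)).
  by apply: eq_sweedler => b c; rewrite !trcons_tcons.
by rewrite trcons_tcons !coprod_atS_tcons ?IHn ?trcons_tcons //; lia.
Qed.

(** [trcons u z] has [n.+1] factors, so the 0-based slot [n] is that of [z]. *)
Lemma coprod_at_last n (u : tpow H n) z :
  coprod_at A n (trcons u z) = Sw z (fun b c => trcons (trcons u b) c).
Proof.
elim: n u => [|n IHn] u.
  move: u; apply: tpow0_eq; [by lin | by lin |].
  rewrite trcons_pure //= -(tcons_pure z) // coprod_at0_tcons.
  by apply: eq_sweedler => b c; rewrite tcons_pure // !trcons_pure // tcons_pure.
move: u; apply: tpowS_eq => [||a u]; [by lin | by lin | ].
rewrite trcons_tcons coprod_atS_tcons // IHn.
rewrite (sweedler_map _ _ _ (tcons_linearr a)).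
by apply: eq_sweedler => b c; rewrite !trcons_tcons.
Qed.

Lemma degen_trcons n i (u : tpow H n.+1) z : (i <= n)%N ->
  hopf_degen A i (trcons u z) = trcons (hopf_degen A i u) z.
Proof.
elim: n i u => [|n IHn] i u le_in.
  move: u; apply: tpowS_eq => [||a u]; [by lin | by lin | ].
  case: i le_in => // _.
  by rewrite trcons_tcons !degen0_tcons (linZ _ _ (trcons_linearl z)).
move: u; apply: tpowS_eq => [||a u]; [by lin | by lin | ].
case: i le_in => [|i] le_in.
  by rewrite trcons_tcons !degen0_tcons (linZ _ _ (trcons_linearl z)).
by rewrite trcons_tcons !degenS_tcons ?IHn ?trcons_tcons //; lia.
Qed.

Lemma degen_last n (u : tpow H n) z :
  hopf_degen A n (trcons u z) = (counit A z : K) *: u.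
Proof.
elim: n u => [|n IHn] u.
  move: u; apply: tpow0_eq; [by lin | by lin |].
  by rewrite trcons_pure // -(tcons_pure z) // degen0_tcons.
move: u; apply: tpowS_eq => [||a u]; [by lin | by lin | ].
by rewrite trcons_tcons degenS_tcons // IHn (linZ _ _ (tcons_linearr a)).
Qed.

Lemma sweedler_mull n g (f : H -> H -> tpow H n) v :
  Sw g f * v = Sw g (fun a b => f a b * v).
Proof. exact: (sweedler_map A g f (tmul_linearl v)). Qed.

Lemma sweedler_mulr n g (f : H -> H -> tpow H n) v :
  v * Sw g f = Sw g (fun a b => v * f a b).
Proof. exact: (sweedler_map A g f (tmul_linearr v)). Qed.

Lemma mul_sweedler n g h (f k : H -> H -> tpow H n) :
  Sw g f * Sw h k = Sw g (fun a b => Sw h (fun c d => f a b * k c d)).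
Proof.
by rewrite sweedler_mull; apply: eq_sweedler => a b; rewrite sweedler_mulr.
Qed.

(** In slot [j] this is multiplicativity of the coproduct. Together with [degenM] it pushes faces
    and degeneracies through the product that defines tau. *)
Lemma coprod_atM n j (u v : tpow H n) : (j < n)%N ->
  coprod_at A j (u * v) = coprod_at A j u * coprod_at A j v.
Proof.
elim: n j u v => [|n IHn] j u v // jn.
move: u; apply: tpowS_eq => [||a u]; [by lin | by lin | ].
move: v; apply: tpowS_eq => [||b v]; [by lin | by lin | ].
case: j jn => [|j] jn.
  rewrite tcons_mul !coprod_at0_tcons sweedlerM; try by lin.
  rewrite mul_sweedler; apply: eq_sweedler => c d.
  by apply: eq_sweedler => e f; rewrite !tcons_mul.
by rewrite tcons_mul !coprod_atS_tcons ?IHn ?tcons_mul //; lia.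
Qed.

Lemma tscale_mul n c d (u v : tpow H n) :
  (c *: u) * (d *: v) = (c * d) *: (u * v).
Proof.
rewrite [LHS](linZ c u (tmul_linearl _)) (linZ d v (tmul_linearr _)).
by rewrite scalerA.
Qed.

Lemma degenM n i (u v : tpow H n.+1) : (i <= n)%N ->
  hopf_degen A i (u * v) = hopf_degen A i u * hopf_degen A i v.
Proof.
elim: n i u v => [|n IHn] i u v le_in;
  (move: u; apply: tpowS_eq => [||a u]; [by lin | by lin | ]);
  (move: v; apply: tpowS_eq => [||b v]; [by lin | by lin | ]).
  case: i le_in => // _.
  by rewrite tcons_mul !degen0_tcons tscale_mul -rmorphM.
case: i le_in => [|i] le_in.
  by rewrite tcons_mul !degen0_tcons tscale_mul -rmorphM.
by rewrite tcons_mul !degenS_tcons ?IHn ?tcons_mul //; lia.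
Qed.

End TensorOperators.

(** * The iterated coproduct and the diagonal action *)

Section IteratedCoproduct.
Variables (K : fieldType) (H : algType K) (A : hopf_structure H).
Local Notation Sw := (sweedler A).
Local Notation S := (antipode A).
Local Notation tc := (tcoprod A).

(** [iter_coprod] keeps splitting the first factor; coassociativity moves the splitting into the
    second leg. For [n = 0] this is the counit axiom. *)
Lemma tcoprodS n h : tc n.+1 h = Sw h (fun a b => tcons a (tc n b)).
Proof.
elim: n h => [|n IHn] h.
  transitivity (Sw h (fun a b => (counit A b : K) *: pure 1 [:: a])).
    rewrite (sweedler_counitr A (f := fun a => pure 1 [:: a])) // => a x y.
    exact: (@pure_multilinear _ _ 1 [::] [::]).
  apply: eq_sweedler => a b.
  by rewrite (linZ _ _ (tcons_linearr a)) tcons_pure.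
change (tc n.+2 h) with (coprod_at A 0 (tc n.+1 h)).
rewrite IHn (sweedler_map A _ _ (coprod_at_linear A (ltn0Sn n))).
transitivity (Sw h (fun a c => Sw a (fun a1 a2 => tcons a1 (tcons a2 (tc n c))))).
  by apply: eq_sweedler => a b; rewrite coprod_at0_tcons.
rewrite (sweedlerA A (f := fun a1 a2 c => tcons a1 (tcons a2 (tc n c)))); try by lin.
apply: eq_sweedler => a b.
by rewrite IHn (sweedler_map A _ _ (tcons_linearr a)).
Qed.

Lemma tcoprodSr n h : tc n.+1 h = Sw h (fun a b => trcons (tc n a) b).
Proof.
elim: n h => [|n IHn] h.
  transitivity (Sw h (fun a b => (counit A a : K) *: pure 1 [:: b])).
    rewrite (sweedler_counitl A (f := fun a => pure 1 [:: a])) // => a x y.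
    exact: (@pure_multilinear _ _ 1 [::] [::]).
  apply: eq_sweedler => a b.
  by rewrite (linZ _ _ (trcons_linearl b)) trcons_pure.
rewrite tcoprodS.
transitivity (Sw h (fun a b => Sw b (fun c d => tcons a (trcons (tc n c) d)))).
  apply: eq_sweedler => a b.
  by rewrite IHn (sweedler_map A _ _ (tcons_linearr a)).
rewrite -(sweedlerA A (f := fun a c d => tcons a (trcons (tc n c) d))); try by lin.
apply: eq_sweedler => a b.
rewrite tcoprodS (sweedler_map A _ _ (trcons_linearl b)).
by apply: eq_sweedler => c d; rewrite trcons_tcons.
Qed.

(** Slot 0 holds by definition of [iter_coprod]; [tcoprodS] reduces the other slots to it. *)
Lemma coprod_at_tcoprod n j h : (j < n)%N ->
  coprod_at A j (tc n h) = tc n.+1 h.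
Proof.
elim: n j h => [|n IHn] [|j] h // jn.
rewrite tcoprodS (sweedler_map A _ _ (coprod_at_linear A jn)) [RHS]tcoprodS.
by apply: eq_sweedler => a b; rewrite coprod_atS_tcons // IHn.
Qed.

Lemma degen_tcoprod n i h : (i <= n)%N ->
  hopf_degen A i (tc n.+1 h) = tc n h.
Proof.
elim: n i h => [|n IHn] [|i] h // le_in; rewrite tcoprodS;
  rewrite (sweedler_map A _ _ (hopf_degen_linear A le_in)).
- transitivity (Sw h (fun a b => (counit A a : K) *: tc 0 b)).
    by apply: eq_sweedler => a b; rewrite degen0_tcons.
  by rewrite sweedler_counitl //; lin.
- transitivity (Sw h (fun a b => (counit A a : K) *: tc n.+1 b)).
    by apply: eq_sweedler => a b; rewrite degen0_tcons.
  by rewrite sweedler_counitl //; lin.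
- rewrite [RHS]tcoprodS; apply: eq_sweedler => a b.
  by rewrite degenS_tcons // IHn.
Qed.

Lemma tcoprodM n g h : tc n (g * h) = tc n g * tc n h.
Proof.
elim: n g h => [|n IHn] g h.
  by rewrite [RHS]tscale_mul [X in _ *: X]mul1r -rmorphM.
rewrite !tcoprodS mul_sweedler sweedlerM; try by lin.
apply: eq_sweedler => a b; apply: eq_sweedler => c d.
by rewrite IHn tcons_mul.
Qed.

Lemma tcoprod1 n : tc n 1 = 1.
Proof.
elim: n => [|n IHn]; first by rewrite /tcoprod rmorph1 scale1r.
by rewrite tcoprodS sweedler1 ?IHn ?tcons11 //; lin.
Qed.

(* Expand the right-hand side as S(g1).g2.(y (x) S(g3) z): the slots of y absorb
   g2, and in the last one g3 S(g4) cancels. *)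
Lemma sweedler_tcoprod_trcons n (y : tpow H n) z g :
  Sw g (fun a b => tc n.+1 (S a) * trcons (tc n b * y) z) =
  trcons y (S g * z).
Proof.
rewrite -[RHS](sweedler_counitl A (f := fun b => trcons y (S b * z))); last by lin.
transitivity (Sw g (fun a b => Sw a (fun a1 a2 =>
    tc n.+1 (S a1) * (tc n.+1 a2 * trcons y (S b * z))))); last first.
  apply: eq_sweedler => a b.
  rewrite -[X in _ *: X]mul1r -(tcoprod1 n.+1).
  rewrite -(sweedler_antipodel A (f := fun x => tc n.+1 x * trcons y (S b * z)));
    last by lin.
  by apply: eq_sweedler => c d; rewrite tcoprodM mulrA.
rewrite (sweedlerA A (f := fun a1 a2 b =>
    tc n.+1 (S a1) * (tc n.+1 a2 * trcons y (S b * z)))); try by lin.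
apply: eq_sweedler => a t.
transitivity (Sw t (fun c w => (counit A w : K) *:
    (tc n.+1 (S a) * trcons (tc n c * y) z))).
  by rewrite (sweedler_counitr A (f := fun c =>
    tc n.+1 (S a) * trcons (tc n c * y) z)) //; lin.
transitivity (Sw t (fun c w => Sw w (fun d b =>
    tc n.+1 (S a) * trcons (tc n c * y) (d * S b * z)))).
  apply: eq_sweedler => c w.
  rewrite (sweedler_antipoder A (f := fun x =>
    tc n.+1 (S a) * trcons (tc n c * y) (x * z))) ?mul1r //; lin.
rewrite -(sweedlerA A (f := fun c d b =>
    tc n.+1 (S a) * trcons (tc n c * y) (d * S b * z))); try by lin.
apply: eq_sweedler => a2 b.
rewrite (tcoprodSr n a2) sweedler_mull sweedler_mulr.
by apply: eq_sweedler => c d; rewrite trcons_mul mulrA.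
Qed.

End IteratedCoproduct.

(** * The twisted antipode and the effect of tau on the diagonal action *)

Section Twisted.
Variables (K : fieldType) (H : algType K) (A : hopf_structure H).
Variables (delta : {lrmorphism H -> K^o}) (sigma : H).
Local Notation Sw := (sweedler A).
Local Notation S := (antipode A).
Local Notation St := (twisted_antipode A delta).
Local Notation tc := (tcoprod A).

(** Mirror image of [sweedler_tcoprod_trcons]: expand the right-hand side as S(g1).g2.(1 (x)
    S(g3).y); the first slot keeps g2, and on y the product g3 S(g4) cancels. *)
Lemma sweedler_tcoprod_tcons n (y : tpow H n) g :
  Sw g (fun a b => tc n.+1 (S a) * tcons b y) = tcons 1 (tc n (S g) * y).
Proof.
rewrite -[RHS](sweedler_counitl A (f := fun b => tcons 1 (tc n (S b) * y)));
  last by lin.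
transitivity (Sw g (fun a b => Sw a (fun a1 a2 =>
    tc n.+1 (S a1) * (tc n.+1 a2 * tcons 1 (tc n (S b) * y))))); last first.
  apply: eq_sweedler => a b.
  rewrite -[X in _ *: X]mul1r -(tcoprod1 A n.+1).
  rewrite -(sweedler_antipodel A
    (f := fun x => tc n.+1 x * tcons 1 (tc n (S b) * y))); last by lin.
  by apply: eq_sweedler => c d; rewrite tcoprodM mulrA.
rewrite (sweedlerA A (f := fun a1 a2 b =>
    tc n.+1 (S a1) * (tc n.+1 a2 * tcons 1 (tc n (S b) * y)))); try by lin.
apply: eq_sweedler => a t.
transitivity (Sw t (fun c w => (counit A w : K) *: (tc n.+1 (S a) * tcons c y))).
  by rewrite (sweedler_counitr A (f := fun c => tc n.+1 (S a) * tcons c y)) //; lin.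
transitivity (Sw t (fun c w => Sw w (fun d b =>
    tc n.+1 (S a) * tcons c (tc n (d * S b) * y)))).
  apply: eq_sweedler => c w.
  rewrite (sweedler_antipoder A (f := fun x =>
    tc n.+1 (S a) * tcons c (tc n x * y))) ?tcoprod1 ?mul1r //; lin.
rewrite -(sweedlerA A (f := fun c d b =>
    tc n.+1 (S a) * tcons c (tc n (d * S b) * y))); try by lin.
apply: eq_sweedler => a2 b.
rewrite (tcoprodS A n a2) sweedler_mull sweedler_mulr.
by apply: eq_sweedler => c d; rewrite tcons_mul mulr1 tcoprodM mulrA.
Qed.

Lemma twisted_antipodeE h : St h = Sw h (fun a b => (delta a : K) *: S b).
Proof. by []. Qed.

(** By coassociativity St(g1) (x) g2 is the sum of the delta(g1) S(g2) (x) g3, so identities for S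
    pass to St with the weight delta(g1). *)
Lemma sweedler_twisted (V : lmodType K) (f : H -> H -> V) g :
    (forall b, linear (f^~ b)) -> (forall a, linear (f a)) ->
  Sw g (fun a b => f (St a) b) =
  Sw g (fun a b => (delta a : K) *: Sw b (fun c d => f (S c) d)).
Proof.
move=> fl fr.
transitivity (Sw g (fun t d => Sw t (fun a c => (delta a : K) *: f (S c) d))).
  apply: eq_sweedler => t d; rewrite twisted_antipodeE (sweedler_map A _ _ (fl d)).
  by apply: eq_sweedler => a c; rewrite (linZ _ _ (fl d)).
rewrite (sweedlerA A (f := fun a c d => (delta a : K) *: f (S c) d)); try by lin.
  by apply: eq_sweedler => a b; rewrite sweedlerZ.
by move=> a d; apply/lin_scale/(linear_comp (lin_antipode A (@lin_id _ H)) (fl d)).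
Qed.

Lemma sweedler_twisted_trcons n (y : tpow H n) z g :
  Sw g (fun a b => tc n.+1 (St a) * trcons (tc n b * y) z) =
  trcons y (St g * z).
Proof.
rewrite (sweedler_twisted (f := fun a b => tc n.+1 a * trcons (tc n b * y) z));
  try by lin.
have L : linear (fun x => trcons y (x * z)) by lin.
rewrite twisted_antipodeE [RHS](sweedler_map A _ _ L); apply: eq_sweedler => a b.
by rewrite sweedler_tcoprod_trcons (linZ _ _ L).
Qed.

(** When [y] ends in sigma, the left side is tau applied after the coproduct of the first factor;
    this yields the relation between tau and delta_1. *)
Lemma sweedler_twisted_tcons n (y : tpow H n) g :
  Sw g (fun a b => tc n.+1 (St a) * tcons b y) = tcons 1 (tc n (St g) * y).
Proof.
rewrite (sweedler_twisted (f := fun a b => tc n.+1 a * tcons b y)); try by lin.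
have L : linear (fun x => tcons 1 (tc n x * y)) by lin.
rewrite twisted_antipodeE [RHS](sweedler_map A _ _ L); apply: eq_sweedler => a b.
by rewrite sweedler_tcoprod_tcons (linZ _ _ L).
Qed.

(** The left antipode axiom for St, with delta in place of the counit. *)
Lemma sweedler_twistedl g : Sw g (fun a b => St a * b) = (delta g : K) *: 1.
Proof.
rewrite (sweedler_twisted (f := fun a b => a * b)); try by lin.
have L : linear (fun x => (delta x : K) *: (1 : H)) by lin.
rewrite -[RHS](sweedler_counitr A g L); apply: eq_sweedler => a b.
by rewrite (sweedler_antipodel A b (@lin_id _ H)) !scalerA mulrC.
Qed.

Lemma twisted_antipodeM g h : St (g * h) = St h * St g.
Proof.
have fl b : linear (fun a => (delta a : K) *: S b) by lin.
have fr a : linear (fun b => (delta a : K) *: S b) by lin.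
rewrite [LHS](sweedlerM A g h fl fr) exchange_sweedler.
have L : linear (fun x => x * St g) by lin.
rewrite (twisted_antipodeE h) [RHS](sweedler_map A h _ L); apply: eq_sweedler => c d.
have L2 : linear (fun x => ((delta c : K) *: S d) * x) by lin.
rewrite (twisted_antipodeE g) [RHS](sweedler_map A g _ L2); apply: eq_sweedler => a b.
by rewrite antipodeM rmorphM -scalerAl -scalerAr scalerA mulrC.
Qed.

Lemma twisted_antipode1 : St 1 = 1.
Proof.
have := sweedler_twistedl 1.
by rewrite sweedler1 ?rmorph1 ?scale1r ?mulr1 //; lin.
Qed.

Lemma hopf_cyclic_tcons n h (y : tpow H n) :
  hopf_cyclic A delta sigma (tcons h y) = tc n.+1 (St h) * trcons y sigma.
Proof.
move: y; apply: tpow_eq_linear => [||s sn]; last first.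
- by rewrite tcons_pure // hopf_cyclic_pure // trcons_pure.
- by lin.
apply: (linear_comp (tcons_linearr h)).
exact/tlift_linear/hopf_cyclic_multilinear.
Qed.

Lemma hopf_cyclic_linear n : linear (@hopf_cyclic K H A delta sigma n).
Proof.
case: n => [|n]; first by [].
exact/tlift_linear/hopf_cyclic_multilinear.
Qed.

(** The left side is the sum of the St(h).St(g1).(g2.y (x) sigma), to which
    [sweedler_twisted_trcons] applies. It computes tau of a tensor that is already a value of
    tau. *)
Lemma hopf_cyclic_diagonal n g h (y : tpow H n) :
  hopf_cyclic A delta sigma (tc n.+1 g * tcons h y) =
  tc n.+1 (St h) * trcons y (St g * sigma).
Proof.
rewrite tcoprodS sweedler_mull (sweedler_map A _ _ (@hopf_cyclic_linear n.+1)).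
rewrite -sweedler_twisted_trcons sweedler_mulr; apply: eq_sweedler => a b.
by rewrite tcons_mul hopf_cyclic_tcons twisted_antipodeM tcoprodM mulrA.
Qed.

End Twisted.

(** * Cosimplicial identities among inner faces and degeneracies *)

Section Cosimplicial.
Variables (K : fieldType) (H : algType K) (A : hopf_structure H).
Local Notation Sw := (sweedler A).

(** For [i < j] the two coproducts act on different factors; for [i = j] this is coassociativity. *)
Lemma coprod_at_coprod_at n i j (u : tpow H n) : (i <= j < n)%N ->
  coprod_at A j.+1 (coprod_at A i u) = coprod_at A i (coprod_at A j u).
Proof.
elim: n i j u => [|n IHn] i j u; first by rewrite andbF.
move=> /andP[le_ij lt_jn]; have lt_in := leq_ltn_trans le_ij lt_jn.
move: u; apply: tpowS_eq => [||a u]; [by lin | by lin | ].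
case: i j le_ij lt_jn lt_in => [|i] [|j] //= le_ij lt_jn lt_in.
- rewrite coprod_at0_tcons !(sweedler_map A _ _ (coprod_at_linear A _)) //.
  transitivity (Sw a (fun b c => Sw c (fun c d => tcons b (tcons c (tcons d u))))).
    apply: eq_sweedler => b c; rewrite coprod_atS_tcons // coprod_at0_tcons.
    exact: (sweedler_map A _ _ (tcons_linearr b)).
  rewrite -(sweedlerA A (f := fun b c d => tcons b (tcons c (tcons d u))));
    try by lin.
  by apply: eq_sweedler => b c; rewrite coprod_at0_tcons.
- rewrite (coprod_atS_tcons A a u) // !coprod_at0_tcons.
  rewrite (sweedler_map A _ _ (coprod_at_linear A _)) //.
  by apply: eq_sweedler => b c; rewrite !coprod_atS_tcons.
by rewrite !coprod_atS_tcons 1?IHn //; lia.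
Qed.

Lemma hopf_degen_degen n i j (u : tpow H n.+2) : (i <= j <= n)%N ->
  hopf_degen A j (hopf_degen A i u) = hopf_degen A i (hopf_degen A j.+1 u).
Proof.
elim: n i j u => [|n IHn] i j u /andP[le_ij le_jn];
  (move: u; apply: tpowS_eq => [||a u]; [by lin | by lin | ]);
  case: i j le_ij le_jn => [|i] [|j] // le_ij le_jn.
- rewrite degenS_tcons // !degen0_tcons; exact: linZ _ _ (hopf_degen_linear A _).
- rewrite degenS_tcons // !degen0_tcons; exact: linZ _ _ (hopf_degen_linear A _).
- rewrite degenS_tcons // !degen0_tcons; exact: linZ _ _ (hopf_degen_linear A _).
by rewrite !degenS_tcons 1?IHn //; lia.
Qed.

Lemma degen_coprod_at_lt n i j (u : tpow H n.+1) : (i < j <= n)%N ->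
  hopf_degen A j.+1 (coprod_at A i u) = coprod_at A i (hopf_degen A j u).
Proof.
elim: n i j u => [|n IHn] i j u /andP[lt_ij le_jn]; first by lia.
move: u; apply: tpowS_eq => [||a u]; [by lin | by lin | ].
case: i j lt_ij le_jn => [|i] [|j] // lt_ij le_jn.
  rewrite degenS_tcons // !coprod_at0_tcons.
  rewrite (sweedler_map A _ _ (hopf_degen_linear A _)) //.
  by apply: eq_sweedler => b c; rewrite !degenS_tcons.
by rewrite coprod_atS_tcons ?degenS_tcons ?coprod_atS_tcons 1?IHn //; lia.
Qed.

(** The two values of [j] correspond to the two counit axioms. *)
Lemma degen_coprod_at_id n i j (u : tpow H n) : (i < n)%N ->
  j = i \/ j = i.+1 -> hopf_degen A j (coprod_at A i u) = u.
Proof.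
move=> lt_in ij; elim: n i j lt_in ij u => // n IHn i j lt_in ij.
have le_jn : (j <= n.+1)%N by lia.
apply: tpowS_eq => [||a u]; [by lin | by lin | ].
case: i lt_in ij => [|i] lt_in ij.
  rewrite coprod_at0_tcons (sweedler_map A _ _ (hopf_degen_linear A le_jn)).
  case: ij => ->.
    rewrite -[RHS](sweedler_counitl A a (tcons_linearl u)).
    by apply: eq_sweedler => b c; rewrite degen0_tcons.
  rewrite -[RHS](sweedler_counitr A a (tcons_linearl u)).
  apply: eq_sweedler => b c; rewrite degenS_tcons // degen0_tcons.
  exact: linZ _ _ (tcons_linearr b).
case: j ij le_jn => [|j] ij le_jn; first by lia.
by rewrite coprod_atS_tcons // degenS_tcons // IHn //; lia.
Qed.

Lemma degen_coprod_at_gt n i j (u : tpow H n.+1) : (j <= i < n)%N ->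
  hopf_degen A j (coprod_at A i.+1 u) = coprod_at A i (hopf_degen A j u).
Proof.
elim: n i j u => [|n IHn] i j u /andP[le_ji lt_in]; first by lia.
move: u; apply: tpowS_eq => [||a u]; [by lin | by lin | ].
case: j le_ji => [|j] le_ji.
  rewrite coprod_atS_tcons ?degen0_tcons; last by lia.
  by rewrite (linZ _ _ (coprod_at_linear A lt_in)).
case: i le_ji lt_in => [|i] le_ji lt_in //.
rewrite coprod_atS_tcons ?degenS_tcons ?coprod_atS_tcons 1?IHn //; lia.
Qed.

End Cosimplicial.

(** * Consequences of the modular pair condition *)

Section ModularPair.
Variables (K : fieldType) (H : algType K) (A : hopf_structure H).
Variables (delta : {lrmorphism H -> K^o}) (sigma : H).
Hypothesis sigma_pair : modular_pair_in_involution A delta sigma.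
Local Notation Sw := (sweedler A).
Local Notation St := (twisted_antipode A delta).
Local Notation tc := (tcoprod A).
Local Notation face := (hopf_face A sigma).
Local Notation degen := (hopf_degen A).
Local Notation tau := (hopf_cyclic A delta sigma).

Lemma sweedler_sigma (V : lmodType K) (f : H -> H -> V) :
    (forall b, linear (f^~ b)) -> (forall a, linear (f a)) ->
  Sw sigma f = f sigma sigma.
Proof.
case: sigma_pair => -[sigmaD _] _ _ fl fr.
by rewrite /sweedler sigmaD tlift2_pure.
Qed.

Lemma counit_sigma : counit A sigma = 1.
Proof. by case: sigma_pair => -[]. Qed.

(** This is [sweedler_twistedl] at the group-like sigma, where delta(sigma) = 1. *)
Lemma twisted_sigma : St sigma * sigma = 1.
Proof.
have := sweedler_twistedl A delta sigma.
rewrite sweedler_sigma; try by lin.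
by case: sigma_pair => _ -> _ ->; rewrite scale1r.
Qed.

(** Anti-multiplicativity turns St(sigma' St(h)) into St(St(h)) St(sigma'), and St(sigma') = sigma;
    the involution condition then reads sigma' St(St(h)) sigma = h. *)
Lemma twisted_twisted h : St (St h) * sigma = sigma * h.
Proof.
case: sigma_pair => _ _ [sigma' [sl sr inv]].
have St_sigma' : St sigma' = sigma.
  (* St(sigma') = St(sigma') St(sigma) sigma = St(sigma sigma') sigma = sigma. *)
  rewrite -[LHS]mulr1 -twisted_sigma mulrA -twisted_antipodeM sr.
  by rewrite twisted_antipode1 mul1r.
by rewrite -[in RHS](inv h) twisted_antipodeM St_sigma' !mulrA sr mul1r.
Qed.

Lemma tcoprod_sigma n s : size s = n ->
  tc n sigma * pure n s = pure n [seq sigma * x | x <- s].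
Proof.
elim: n s => [|n IHn] [|x s] // => [_|[sn]].
  by rewrite /tcoprod counit_sigma scale1r mul1r.
rewrite tcoprodS sweedler_sigma; try by lin.
by rewrite -tcons_pure // tcons_mul IHn // tcons_pure // size_map.
Qed.

Lemma tcoprod_twisted_sigma n : tc n (St sigma) * tc n sigma = 1.
Proof. by rewrite -tcoprodM twisted_sigma tcoprod1. Qed.

(** * Cosimplicial identities including the outer faces *)

Lemma face0E n (u : tpow H n) : face 0 u = tcons 1 u.
Proof. by []. Qed.

Lemma face_lastE n (u : tpow H n) : face n.+1 u = trcons u sigma.
Proof. by rewrite /hopf_face eqxx. Qed.

Lemma faceSE n i (u : tpow H n) : (i < n)%N -> face i.+1 u = coprod_at A i u.
Proof. by move=> lt_in; rewrite /hopf_face /= eqSS ltn_eqF. Qed.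

Lemma hopf_face_linear n i : (i <= n.+1)%N -> linear (@hopf_face K H A sigma n i).
Proof.
case: i => [_|i]; first exact: tcons_linearr.
rewrite ltnS leq_eqVlt => /predU1P[->|lt_in] a u v.
  by rewrite !face_lastE trcons_linearl.
by rewrite !faceSE // coprod_at_linear.
Qed.

(** The outer faces contribute two new coincidences: Delta(1) = 1 (x) 1 for the first two faces and
    Delta(sigma) = sigma (x) sigma for the last two. *)
Lemma hopf_face_face n i j (u : tpow H n) : (i < j <= n.+2)%N ->
  face j (face i u) = face i (face j.-1 u).
Proof.
case: j => // j; rewrite [j.+1.-1]/= !ltnS => /andP[le_ij].
rewrite leq_eqVlt => /predU1P[j_eq|lt_jn].
  subst j; rewrite !face_lastE.
  case: i le_ij => [|i] le_ij; first by rewrite !face0E trcons_tcons.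
  rewrite ltnS leq_eqVlt in le_ij; case/predU1P: le_ij => [->|lt_in].
    by rewrite face_lastE faceSE // coprod_at_last sweedler_sigma //; lin.
  by rewrite !faceSE ?coprod_at_trcons //; lia.
rewrite faceSE //; case: i le_ij => [|i] le_ij.
  rewrite !face0E; case: j lt_jn le_ij => [|j] lt_jn _.
    by rewrite coprod_at0_tcons face0E sweedler1 //; lin.
  by rewrite coprod_atS_tcons ?faceSE //; lia.
case: j lt_jn le_ij => // j lt_jn le_ij.
by rewrite !faceSE 1?coprod_at_coprod_at //; lia.
Qed.

Lemma hopf_degen_face_lt n i j (u : tpow H n.+1) : (i < j <= n.+1)%N ->
  degen j (face i u) = face i (degen j.-1 u).
Proof.
case: j => // j /andP[lt_ij le_jn] /=.
case: i lt_ij => [|i] lt_ij; first by rewrite !face0E degenS_tcons.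
by rewrite !faceSE 1?degen_coprod_at_lt //; lia.
Qed.

Lemma hopf_degen_face_id n i j (u : tpow H n) : (j <= n)%N -> i = j \/ i = j.+1 ->
  degen j (face i u) = u.
Proof.
move=> le_jn; case: i => [|i] ij.
  by case: ij => // <-; rewrite face0E degen0_tcons rmorph1 scale1r.
have [i_eq|lt_in] : i = n \/ (i < n)%N by lia.
  (* At the last face the bound on [j] leaves only [j = n], and the counit removes sigma. *)
  have -> : j = n by lia.
  by rewrite i_eq face_lastE degen_last counit_sigma scale1r.
by rewrite faceSE // degen_coprod_at_id //; lia.
Qed.

Lemma hopf_degen_face_gt n i j (u : tpow H n.+1) : (j.+1 < i <= n.+2)%N ->
  degen j (face i u) = face i.-1 (degen j u).
Proof.
case: i => [|[|i]] // /andP[le_ji]; rewrite [i.+2.-1]/= !ltnS in le_ji *.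
rewrite leq_eqVlt => /predU1P[i_eq|lt_in].
  by rewrite i_eq !face_lastE degen_trcons //; lia.
by rewrite !faceSE 1?degen_coprod_at_gt //; lia.
Qed.

(** * Compatibility of tau with faces and degeneracies, and its order *)

Lemma trcons_tpow0 (u : tpow H 0) z : trcons u z = tcons z u.
Proof.
move: u; apply: tpow0_eq; [by lin | by lin |].
by rewrite trcons_pure // tcons_pure.
Qed.

Lemma tcoprod_sigma_tcons n (u : tpow H n) :
  tc n.+1 sigma * tcons 1 u = tcons sigma (tc n sigma * u).
Proof.
by rewrite tcoprodS sweedler_sigma ?tcons_mul ?mulr1 //; lin.
Qed.

Lemma hopf_cyclic_face n i (u : tpow H n) : (1 <= i <= n.+1)%N ->
  tau (face i u) = face i.-1 (tau u).
Proof.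
move=> i_bounds; have tau_face_lin : linear (fun u : tpow H n => tau (face i u)).
  by apply: linear_comp (hopf_face_linear _) (@hopf_cyclic_linear _ _ _ _ _ _); lia.
have face_tau_lin : linear (fun u : tpow H n => face i.-1 (tau u)).
  by apply: linear_comp (@hopf_cyclic_linear _ _ _ _ _ _) (hopf_face_linear _); lia.
case: n u i_bounds tau_face_lin face_tau_lin => [|n] u.
  (* On H^0 only [i = 1] is left: tau_1(sigma) = St(sigma) sigma = 1. *)
  case: i => [|[|i]] // _ _ _; rewrite face_lastE [1.-1]/= face0E trcons_tpow0.
  rewrite hopf_cyclic_tcons trcons_tpow0.
  have tc0_sigma : tc 0 sigma = 1 by rewrite /tcoprod counit_sigma scale1r.
  have := tcoprod_sigma_tcons u; rewrite tc0_sigma mul1r => <-.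
  by rewrite mulrA tcoprod_twisted_sigma mul1r.
move=> i_bounds tau_face_lin face_tau_lin; move: u.
apply: tpowS_eq => // h y; rewrite hopf_cyclic_tcons.
case: i i_bounds {tau_face_lin face_tau_lin} => [|[|i]] // i_bounds; rewrite [_.-1]/=.
  (* For [i = 1] the factor consumed by tau is itself split; [sweedler_twisted_tcons] applies with
     [trcons y sigma] as [y]. *)
  rewrite faceSE // coprod_at0_tcons.
  rewrite (sweedler_map A _ _ (@hopf_cyclic_linear _ _ A delta sigma n.+2)).
  rewrite face0E -sweedler_twisted_tcons; apply: eq_sweedler => a b.
  by rewrite hopf_cyclic_tcons trcons_tcons.
have [i_eq|lt_in] : i = n \/ (i < n)%N by lia.
  (* Last face: the right side splits the sigma appended by tau, and Delta(sigma) = sigma (x)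
     sigma. *)
  rewrite i_eq face_lastE trcons_tcons hopf_cyclic_tcons faceSE //.
  rewrite coprod_atM // coprod_at_tcoprod // coprod_at_last sweedler_sigma //; lin.
rewrite !faceSE ?coprod_atS_tcons ?hopf_cyclic_tcons ?coprod_atM //; try lia.
by rewrite coprod_at_tcoprod ?coprod_at_trcons //; lia.
Qed.

Lemma hopf_cyclic_face0 n (u : tpow H n) : tau (face 0 u) = face n.+1 u.
Proof.
by rewrite face0E face_lastE hopf_cyclic_tcons twisted_antipode1 tcoprod1 mul1r.
Qed.

Lemma hopf_cyclic_degen n i (u : tpow H n.+1) : (1 <= i <= n)%N ->
  tau (degen i u) = degen i.-1 (tau u).
Proof.
case: i => // i; rewrite [i.+1.-1]/=; case: n u => // n u.
rewrite ltnS => le_in; move: u; apply: tpowS_eq => [||h y].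
- by apply: linear_comp (hopf_degen_linear A _) (@hopf_cyclic_linear _ _ _ _ _ _); lia.
- by apply: linear_comp (@hopf_cyclic_linear _ _ _ _ _ _) (hopf_degen_linear A _); lia.
by rewrite degenS_tcons // !hopf_cyclic_tcons degenM ?degen_tcoprod ?degen_trcons //;
  lia.
Qed.

Lemma hopf_cyclic_degen0 n (u : tpow H n.+1) :
  tau (degen 0 u) = degen n (tau (tau u)).
Proof.
have tau_lin k : linear (@hopf_cyclic K H A delta sigma k).
  exact: hopf_cyclic_linear.
move: u; apply: tpowS_eq => [||h y].
- by apply: linear_comp (hopf_degen_linear A _) (tau_lin _).
- by apply: linear_comp (linear_comp (tau_lin _) (tau_lin _)) (hopf_degen_linear A _).
rewrite degen0_tcons (linZ _ _ (tau_lin n)) hopf_cyclic_tcons.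
have counit_sigmaM : counit A (sigma * h) = counit A h.
  by rewrite rmorphM /= counit_sigma mul1r.
(* On H^1 the second tau consumes the sigma appended by the first, which leaves the factor
   eps(St(sigma)) = 1. *)
case: n y => [|n] y.
  have tc0_sigma : tc 0 sigma = 1 by rewrite /tcoprod counit_sigma scale1r.
  have tc0_twisted : tc 0 (St sigma) = 1.
    by rewrite -[LHS]mulr1 -tc0_sigma tcoprod_twisted_sigma.
  rewrite trcons_tpow0 hopf_cyclic_diagonal twisted_twisted degenM //.
  by rewrite degen_tcoprod // degen_last counit_sigmaM tc0_twisted mul1r.
have L : linear (fun y : tpow H n.+1 => tc n.+2 (St h) * trcons y sigma).
  by lin.
move: y; apply: tpowS_eq => [||h2 y].
- exact: lin_scale (tau_lin _).
- exact: linear_comp (linear_comp L (tau_lin _)) (hopf_degen_linear A _).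
(* Here tau^2(h (x) h2 (x) y) = St(h2).(y (x) sigma (x) sigma h), whose last slot is the one that is
   removed. *)
rewrite hopf_cyclic_tcons trcons_tcons hopf_cyclic_diagonal twisted_twisted degenM //.
rewrite degen_tcoprod // degen_last counit_sigmaM.
by rewrite [RHS](linZ _ _ (tmul_linearr _)).
Qed.

(* The class of [s], of size [n.+2], in the quotient of H^(n+2) by the diagonal
   action of H twisted by delta, this quotient being identified with H^(n+1). *)
Let diagonal_class n (s : seq H) : tpow H n.+1 :=
  tc n.+1 (St s`_0) * pure n.+1 (behead s).

(** This is [hopf_cyclic_diagonal] with g = St(h); its new last entry St(St(h)) sigma is sigma h by
    [twisted_twisted]. *)
Lemma cyclic_diagonal_class n h s : size s = n.+1 ->
  tau (diagonal_class n (h :: s)) = diagonal_class n (rcons s (sigma * h)).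
Proof.
case: s => // h1 s [sn]; rewrite /diagonal_class.
change (behead (h :: h1 :: s)) with (h1 :: s).
by rewrite -tcons_pure // hopf_cyclic_diagonal twisted_twisted trcons_pure.
Qed.

Lemma iter_cyclic_diagonal_class n s1 s2 : size (s1 ++ s2) = n.+2 ->
  iter (size s1) (@hopf_cyclic K H A delta sigma n.+1)
    (diagonal_class n (s1 ++ s2)) =
  diagonal_class n (s2 ++ [seq sigma * x | x <- s1]).
Proof.
elim: s1 s2 => [|h s1 IHs] s2; first by rewrite cats0.
move=> [s_size].
rewrite iterSr cyclic_diagonal_class // rcons_cat IHs ?cat_rcons //.
by rewrite -rcons_cat size_rcons s_size.
Qed.

Lemma hopf_cyclic_order n (u : tpow H n) :
  iter n.+1 (@hopf_cyclic K H A delta sigma n) u = u.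
Proof.
case: n u => [|n] //; apply: tpow_eq_linear => // [|s sn].
  elim: (n.+2) => // k IHk.
  exact: linear_comp IHk (@hopf_cyclic_linear _ _ _ _ _ _).
(* The leading 1 makes [n.+2] entries, so the [n.+2] applications of tau rotate each entry exactly
   once around. *)
have -> : pure n.+1 s = diagonal_class n (1 :: s).
  by rewrite /diagonal_class twisted_antipode1 tcoprod1 mul1r.
have := @iter_cyclic_diagonal_class n (1 :: s) [::].
rewrite cats0 /= sn => -> //.
(* What remains is St(sigma).(sigma.s), and St(sigma) sigma = 1. *)
rewrite /diagonal_class mulr1 -tcoprod_sigma // mulrA.
by rewrite tcoprod_twisted_sigma mul1r twisted_antipode1 tcoprod1 mul1r.
Qed.

End ModularPair.

Theorem theorem3 (R : realType) (H : algType R[i]) (A : hopf_structure H)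
    (delta : {lrmorphism H -> R[i]^o}) (sigma : H)
    (delta_sigma : modular_pair_in_involution A delta sigma) :
  is_cocyclic_module (X := fun n : nat => tpow H n)
    (hopf_face A sigma) (hopf_degen A) (hopf_cyclic A delta sigma).
Proof.
apply: IsCocyclicModule.
- by move=> n i; apply: hopf_face_linear.
- by move=> n i; apply: hopf_degen_linear.
- by move=> n; apply: hopf_cyclic_linear.
- by move=> n i j u; apply: (hopf_face_face delta_sigma).
- by move=> n i j u; apply: hopf_degen_degen.
- by move=> n i j u; apply: hopf_degen_face_lt.
- by move=> n i j u; apply: (hopf_degen_face_id delta_sigma).
- by move=> n i j u; apply: hopf_degen_face_gt.
- by move=> n i u; apply: (hopf_cyclic_face delta_sigma).
- by move=> n u; apply: hopf_cyclic_face0.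
- by move=> n i u; apply: hopf_cyclic_degen.
- by move=> n u; apply: (hopf_cyclic_degen0 delta_sigma).
- by move=> n u; apply: (hopf_cyclic_order delta_sigma).
Qed.
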